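(* Let $\mathcal{C}=(\mathcal{P},\mathcal{L},\mathcal{I})$ be a linear point-line configuration with $n$ points and with connected components $\mathcal{C}_1,\dots,\mathcal{C}_\omega$. Assume that each of $\mathcal{C}_1,\dots,\mathcal{C}_\omega$ is the point-line configuration of a maximal matroid. Then the following statements are equivalent: (1) The configuration $\mathcal{C}$ is liftable (over $\mathbb{C}$). (2) For every $n$-tuple of distinct collinear points of $\mathbb{P}^2_{\mathbb{C}}$ labelled by the points of $\mathcal{C}$, the linear system $\Lambda z=0$, where $\Lambda$ is the collinearity matrix of $\mathcal{C}$ at these points, has solution space of dimension at least $3\omega$, or equivalently $n-3\omega\ge\operatorname{rk}\Lambda$.
   Context: A point-line configuration $(\mathcal{P},\mathcal{L},\mathcal{I})$ (points, lines, incidences; a line is identified with its set of points) is linear if any two points lie on at most one common line and every line contains at least two points. Given a total order on $\mathcal{P}$, $G_{\mathcal{C}}$ is the graph on $\mathcal{P}$ with an edge $p_ip_j$ ($p_i<p_j$) whenever $p_i,p_j$ lie on a line $\ell$ and no $p_k\in\ell$ satisfies $p_i<p_k<p_j$; the connected components of $\mathcal{C}$ are the sub-configurations corresponding to the connected components of $G_{\mathcal{C}}$, and $\omega$ is their number. Maximal matroids. For a simple rank-$3$ matroid $M$, $\mathcal{C}_M$ is the configuration whose points are the ground set and whose lines are the rank-two flats of size at least $3$. For matroids on the same ground set, $M\le N$ if every dependent set of $M$ is dependent in $N$. A simple rank-$3$ matroid $M$ such that $\mathcal{C}_M$ has no triplets of concurrent lines (every point lies on at most two lines) is maximal if it is maximal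 for this order among the realisable (over $\mathbb{C}$) simple rank-$3$ matroids (on the same ground set) with no triplets of concurrent lines. Liftable. A non-degenerate realisation of $\mathcal{C}$ is an $n$-tuple of points of $\mathbb{P}^2_{\mathbb{C}}$ in bijection with the points of $\mathcal{C}$ such that (non-)collinear points correspond to (non-)collinear points. $\mathcal{C}$ is liftable if every $n$-tuple of distinct collinear points of $\mathbb{P}^2_{\mathbb{C}}$ (labelled by the points of $\mathcal{C}$) is the image, under projection from a point outside their line onto that line, of a non-degenerate realisation of $\mathcal{C}$. Collinearity matrix. Given collinear points $P_1,\dots,P_n$ of $\mathbb{P}^2_{\mathbb{C}}$ and a point $P$ not collinear with them, choose coordinates with $P=(0,0,1)^t$ and $P_j=(x_j,1,0)^t$, and put $[P_iP_j]=x_i-x_j$. The matrix $\Lambda$ has columns indexed by $j\in[n]$ and a row for each triple $i=(i_1,i_2,i_3)$ of points lying on a common line of $\mathcal{C}$, with entries $[P_{i_2}P_{i_3}]$ in column $i_1$, $-[P_{i_1}P_{i_3}]$ in column $i_2$, $[P_{i_1}P_{i_2}]$ in column $i_3$, and $0$ elsewhere. *)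

(* Defs.v *)
From mathcomp Require Import all_boot all_order all_algebra.
From mathcomp Require Import reals complex.

Set Implicit Arguments.
Unset Strict Implicit.
Unset Printing Implicit Defensive.

Import Order.TTheory GRing.Theory Num.Theory.
Local Open Scope ring_scope.

(* The points of a configuration or of a matroid form a subset of an ambient
   finite type, so that sub-configurations live over the same type. *)
Record config (T : finType) := Config {
  points : {set T};
  lines : {set {set T}}
}.

Definition linear_config (T : finType) (C : config T) : Prop :=
  [/\ forall l, l \in lines C -> l \subset points C,
      forall l, l \in lines C -> (2 <= #|l|)%N &
      forall p q l l', p != q -> l \in lines C -> l' \in lines C ->
        p \in l -> q \in l -> p \in l' -> q \in l' -> l = l'].

Definition no_concurrent_triple (T : finType) (C : config T) : Prop :=
  forall p, p \in points C -> (#|[set l in lines C | p \in l]| <= 2)%N.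

Section Components.
Variables (n : nat) (C : config 'I_n).

Definition consecutive (l : {set 'I_n}) (i j : 'I_n) : bool :=
  [&& i \in l, j \in l, (i < j)%N & [forall k in l, ~~ (i < k < j)%N]].

Definition config_graph : rel 'I_n := fun i j =>
  [exists l in lines C, consecutive l i j || consecutive l j i].

Definition component_sets : {set {set 'I_n}} :=
  equivalence_partition (connect config_graph) (points C).

Definition omega : nat := #|component_sets|.

Definition subconfig (A : {set 'I_n}) : config 'I_n :=
  Config A [set l in lines C | l \subset A].

End Components.

Record matroid (T : finType) := Matroid {
  ground : {set T};
  indep : {set {set T}};
  indep_sub : forall A, A \in indep -> A \subset ground;
  indep0 : set0 \in indep;
  indepS : forall A B : {set T}, A \subset B -> B \in indep -> A \in indep;
  indep_aug : forall A B : {set T}, A \in indep -> B \in indep ->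
    (#|A| < #|B|)%N -> exists2 x, x \in B :\: A & x |: A \in indep
}.

Section Matroids.
Variable T : finType.
Implicit Types (M N : matroid T) (A F : {set T}).

Definition mrank M A : nat := \max_(I in indep M | I \subset A) #|I|.

Definition flat M F : bool :=
  (F \subset ground M) &&
  [forall x in ground M :\: F, (mrank M F < mrank M (x |: F))%N].

Definition dependent M A : bool := (A \subset ground M) && (A \notin indep M).

Definition simple_matroid M : Prop :=
  forall A, A \subset ground M -> (#|A| <= 2)%N -> A \in indep M.

Definition matroid_le M N : Prop :=
  ground M = ground N /\ forall A, dependent M A -> dependent N A.

Definition matroid_config M : config T :=
  Config (ground M)
    [set F : {set T} | [&& flat M F, mrank M F == 2%N & (3 <= #|F|)%N]].

Definition realisable (K : fieldType) M : Prop :=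
  exists (d : nat) (v : T -> 'cV[K]_d), forall A, A \subset ground M ->
    (A \in indep M) = free [seq v x | x <- enum A].

Definition admissible (K : fieldType) M : Prop :=
  [/\ simple_matroid M, mrank M (ground M) = 3%N,
      no_concurrent_triple (matroid_config M) & realisable K M].

Definition maximal_matroid (K : fieldType) M : Prop :=
  admissible K M /\
  forall N, admissible K N -> matroid_le M N -> matroid_le N M.

End Matroids.

(* The projective plane over K: points and lines are the subspaces of K^3 of
   dimension 1 and 2, and incidence is inclusion. *)
Definition psubspace (K : fieldType) (d : nat) :=
  {U : {vspace 'cV[K]_3} | \dim U == d}.
Definition ppoint (K : fieldType) := psubspace K 1.
Definition pline (K : fieldType) := psubspace K 2.

Definition on_line (K : fieldType) (P : ppoint K) (l : pline K) : bool :=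
  (val P <= val l)%VS.

(* The point XP /\ l for a point X distinct from P, when P is not on l; for
   X = P this is the zero subspace, which is not a point. *)
Definition projection (K : fieldType) (P : ppoint K) (l : pline K)
    (X : ppoint K) : {vspace 'cV[K]_3} :=
  ((val P + val X) :&: val l)%VS.

Section Lifting.
Variables (K : fieldType) (n : nat) (C : config 'I_n).

Definition distinct_on_line (l : pline K) (Q : 'I_n -> ppoint K) : Prop :=
  injective Q /\ forall j, on_line (Q j) l.

Definition nondegenerate_realisation (V : 'I_n -> ppoint K) : Prop :=
  injective V /\
  forall i j k : 'I_n, uniq [:: i; j; k] ->
    (exists2 l, l \in lines C & [/\ i \in l, j \in l & k \in l]) <->
    (exists l : pline K, [/\ on_line (V i) l, on_line (V j) l & on_line (V k) l]).

Definition liftable : Prop :=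
  forall (l : pline K) (Q : 'I_n -> ppoint K), distinct_on_line l Q ->
  exists (P : ppoint K) (V : 'I_n -> ppoint K),
    [/\ ~~ on_line P l, nondegenerate_realisation V &
        forall j, projection P l (V j) = val (Q j)].

(* The basis e is a choice of homogeneous coordinates in which
   P = (0, 0, 1)^t and Q_j = (x_j, 1, 0)^t for all j. *)
Definition has_coords (e : 3.-tuple 'cV[K]_3) (P : ppoint K)
    (Q : 'I_n -> ppoint K) (x : 'I_n -> K) : Prop :=
  let pt a b c := <[a *: e`_0 + b *: e`_1 + c *: e`_2]>%VS in
  [/\ basis_of fullv e, val P = pt 0 0 1 & forall j, val (Q j) = pt (x j) 1 0].

(* A triple of points is listed in increasing order; reordering it would only
   change the sign of its row. *)
Definition collinear_triples : {set 'I_n * 'I_n * 'I_n} :=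
  [set t : 'I_n * 'I_n * 'I_n | (t.1.1 < t.1.2 < t.2)%N &
     [exists l in lines C, [&& t.1.1 \in l, t.1.2 \in l & t.2 \in l]]].

Definition collinearity_matrix (x : 'I_n -> K) :
    'M[K]_(#|collinear_triples|, n) :=
  let br i j := x i - x j in
  \matrix_(r, c)
    let: (i1, i2, i3) := enum_val r in
    if c == i1 then br i2 i3
    else if c == i2 then - br i1 i3
    else if c == i3 then br i1 i2
    else 0.

Definition solution_space (m : nat) (A : 'M[K]_(m, n)) : {vspace 'cV[K]_n} :=
  lker (linfun (mulmx A : 'cV[K]_n -> 'cV[K]_m)).

End Lifting.

Arguments liftable K {n} C.

(* Main.v *)
(* In coordinates P = (0,0,1), Q_j = (x_j,1,0), the lifts of the Q_j are the
   points (x_j,1,z_j), and z lies in ker Lambda iff collinear triples lift to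
   collinear triples.  The kernel is the direct sum of the kernels attached to
   the components.  If x,z is a non-degenerate lift, each component contributes
   the three independent vectors 1, x, z, which gives (1) => (2).

   For the converse, every linear family of lines with at most two lines through
   each point is realised by general tangents to a conic, so maximality is a
   combinatorial condition.  Degenerating a maximal matroid M (merging a set S of
   lines into one, moving a point lying on a single line to another line, adding
   a transversal) shows: every proper set S of at least two lines admits a line
   outside S with two points on lines of S.  Growing from two meeting lines, an
   element of the kernel of M is determined by its values at three points, so
   each component contributes at most 3, for every x, and (2) forces exactly 3.
   If M has more than two lines, take the last line v met by this process: it has
   at least three points on other lines (otherwise M would not be maximal), and
   moving one of them off v, along the other line through it, gives an x for which
   the contribution is 2.  So all components are pairs of meeting lines, for which
   general elements of the kernel are non-degenerate lifts. *)
Require Import Defs.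
From mathcomp Require Import all_boot all_order all_algebra.
From mathcomp Require Import reals complex ring zify.
Import Order.TTheory GRing.Theory Num.Theory.

Set Implicit Arguments.
Unset Strict Implicit.
Unset Printing Implicit Defensive.
Local Open Scope ring_scope.

(** * Generic parameters *)

(** This is the only property of the complex numbers that the whole proof uses. *)
Definition infinite_field (K : fieldType) := forall s : seq K, exists t, t \notin s.

Section Generic.
Variables (K : fieldType) (Kinf : infinite_field K).

Lemma infinite_uniq m : exists2 s : seq K, uniq s & size s = m.
Proof.
elim: m => [|m [s us <-]]; first by exists [::].
by have [t ts] := Kinf s; exists (t :: s) => //=; rewrite ts.
Qed.

Lemma nonroot (ps : seq {poly K}) :
  (forall p, p \in ps -> p != 0) -> exists t, forall p, p \in ps -> p.[t] != 0.
Proof.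
move=> nz; pose q := \prod_(p <- ps) p.
have q0 : q != 0 by rewrite prodf_seq_neq0; apply/allP => p /nz.
have [s us sz] := infinite_uniq (size q).
have : ~~ all (root q) s.
  by apply/negP => rs; have := max_poly_roots q0 rs us; rewrite sz ltnn.
case/allPn => t _; rewrite rootE horner_prod prodf_seq_neq0 => /allP ht.
by exists t => p /ht.
Qed.

(** Being polynomial along every affine line of the parameter space is all that genericity arguments
    need: they reduce to counting roots in one variable, and multivariate polynomials are
    avoided. *)
Definition poly_on_lines (V : Type) (f : (V -> K) -> K) :=
  forall t t' : V -> K, exists p : {poly K},
    forall s, f (fun v => t v + s * (t' v - t v)) = p.[s].

Lemma poly_on_lines_coord (V : Type) (v : V) : poly_on_lines (fun t => t v).
Proof.
by move=> t t'; exists ((t v)%:P + (t' v - t v) *: 'X) => s; rewrite !hornerE mulrC.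
Qed.

Lemma poly_on_lines_const (V : Type) (c : K) : poly_on_lines (fun _ : V -> K => c).
Proof. by move=> t t'; exists c%:P => s; rewrite hornerC. Qed.

Lemma poly_on_lines_add (V : Type) (f g : (V -> K) -> K) :
  poly_on_lines f -> poly_on_lines g -> poly_on_lines (fun t => f t + g t).
Proof.
move=> pf pg t t'; have [p hp] := pf t t'; have [q hq] := pg t t'.
by exists (p + q) => s; rewrite hornerD hp hq.
Qed.

Lemma poly_on_lines_opp (V : Type) (f : (V -> K) -> K) :
  poly_on_lines f -> poly_on_lines (fun t => - f t).
Proof.
move=> pf t t'; have [p hp] := pf t t'.
by exists (- p) => s; rewrite hornerN hp.
Qed.

Lemma poly_on_lines_mul (V : Type) (f g : (V -> K) -> K) :
  poly_on_lines f -> poly_on_lines g -> poly_on_lines (fun t => f t * g t).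
Proof.
move=> pf pg t t'; have [p hp] := pf t t'; have [q hq] := pg t t'.
by exists (p * q) => s; rewrite hornerM hp hq.
Qed.

(** By induction, some [t] is good for the tail and some [t'] for the head. On the line through them
    every function is a polynomial in [s] that is nonzero at [s = 0] or at [s = 1], so some [s]
    avoids all the roots. The predicate [P] lets the search stay inside a linear space, such as a
    space of lifts. *)
Lemma common_nonzero (V : Type) (I : eqType) (P : (V -> K) -> Prop)
    (f : I -> (V -> K) -> K) (js : seq I) (t0 : V -> K) :
  P t0 ->
  (forall t t' s, P t -> P t' -> P (fun v => t v + s * (t' v - t v))) ->
  (forall j (t t' : V -> K), t =1 t' -> f j t = f j t') ->
  (forall j, j \in js -> poly_on_lines (f j)) ->
  (forall j, j \in js -> exists2 t, P t & f j t != 0) ->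
  exists2 t, P t & forall j, j \in js -> f j t != 0.
Proof.
move=> P0 Pl fext; elim: js => [|j js IH] pol ex; first by exists t0.
have [||t Pt ht] := IH.
- by move=> i ijs; apply: pol; rewrite inE ijs orbT.
- by move=> i ijs; apply: ex; rewrite inE ijs orbT.
have [t' Pt' ht'] := ex j (mem_head _ _).
have [ps psP psE] : exists2 ps : seq {poly K}, (forall p, p \in ps -> p != 0) &
   forall i, i \in j :: js -> exists2 p, p \in ps &
     forall s, f i (fun v => t v + s * (t' v - t v)) = p.[s].
  have : forall i, i \in j :: js -> exists2 p, p != 0 &
     forall s, f i (fun v => t v + s * (t' v - t v)) = p.[s].
    move=> i ij; have [p hp] := pol i ij t t'; exists p => //.
    apply/eqP => p0; move: ij; rewrite inE => /orP [/eqP ij|ij].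
      have := hp 1; rewrite p0 horner0 => /eqP; apply/negP.
      by rewrite ij (fext _ _ t') // => v; rewrite mul1r addrC subrK.
    have := hp 0; rewrite p0 horner0 => /eqP; apply/negP.
    by rewrite (fext _ _ t) ?ht // => v; rewrite mul0r addr0.
  elim: (j :: js) => [|i r IHr] h; first by exists [::].
  have [|ps psP psE] := IHr; first by move=> k kr; apply: h; rewrite inE kr orbT.
  have [p p0 hp] := h i (mem_head _ _).
  exists (p :: ps) => [q|k]; rewrite inE; first by case/orP=> [/eqP->|/psP].
  case/orP=> [/eqP->|/psE [q qps hq]]; first by exists p; rewrite // mem_head.
  by exists q => //; rewrite inE qps orbT.
have [s hs] := nonroot psP.
exists (fun v => t v + s * (t' v - t v)); first exact: Pl.
by move=> i /psE [p /hs ps0 ->].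
Qed.

End Generic.

Section Cdet.
Variable K : fieldType.

(* The determinant with rows [(x1, 1, z1)], [(x2, 1, z2)], [(x3, 1, z3)]. *)
Definition det3 (x1 z1 x2 z2 x3 z3 : K) : K :=
  (x2 - x3) * z1 - (x1 - x3) * z2 + (x1 - x2) * z3.

Definition cdet (T : Type) (x z : T -> K) (i j k : T) : K :=
  det3 (x i) (z i) (x j) (z j) (x k) (z k).

Lemma cdetC (T : Type) (x z : T -> K) i j k : cdet x z j i k = - cdet x z i j k.
Proof. by rewrite /cdet /det3; ring. Qed.

Lemma cdetR (T : Type) (x z : T -> K) i j k : cdet x z j k i = cdet x z i j k.
Proof. by rewrite /cdet /det3; ring. Qed.

End Cdet.

(** * Generic tangents to a conic *)

Section Realisation.
Variables (K : fieldType) (Kinf : infinite_field K).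

(** Each inequality is the nonvanishing of a polynomial, so by [common_nonzero] it is enough to
    satisfy them one at a time, which vectors of zeros and ones do. The point with coordinates
    [t a + t b] and [t a * t b] is the intersection of the tangents with parameters [t a] and
    [t b]. *)
Lemma generic_parameters (V : finType) : exists t : V -> K,
  [/\ forall a b, a != b -> t a != t b,
      forall a b c d, uniq [:: a; b; c; d] -> t a + t b != t c + t d &
      forall a b c d e f, uniq [:: a; b; c; d; e; f] ->
        det3 (t a + t b) (t a * t b) (t c + t d) (t c * t d) (t e + t f) (t e * t f) != 0].
Proof.
pose f1 (q : V * V) (t : V -> K) := t q.1 - t q.2.
pose f2 (q : V * V * V * V) (t : V -> K) :=
  let: (a, b, c, d) := q in t a + t b - (t c + t d).
pose f3 (q : V * V * V * V * V * V) (t : V -> K) :=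
  let: (a, b, c, d, e, f) := q in
  det3 (t a + t b) (t a * t b) (t c + t d) (t c * t d) (t e + t f) (t e * t f).
pose J := (V * V + V * V * V * V + V * V * V * V * V * V)%type.
pose f (j : J) := match j with
  | inl (inl q) => f1 q | inl (inr q) => f2 q | inr q => f3 q end.
pose ok (j : J) := match j with
  | inl (inl q) => q.1 != q.2
  | inl (inr q) => let: (a, b, c, d) := q in uniq [:: a; b; c; d]
  | inr q => let: (a, b, c, d, e, f) := q in uniq [:: a; b; c; d; e; f] end.
have [||||t _ ht] := @common_nonzero K Kinf V J (fun=> True) f (enum ok) (fun=> 0) I.
- by [].
- case=> [[[a b]|[[[a b] c] d]]|[[[[[a b] c] d] e] g]] t t' tt' /=;
    by rewrite /f1 /f2 /f3 /= !tt'.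
- case=> [[[a b]|[[[a b] c] d]]|[[[[[a b] c] d] e] g]] _ /=; rewrite /f1 /f2 /f3 /det3 /=;
  by repeat first [ apply: poly_on_lines_add | apply: poly_on_lines_opp
                  | apply: poly_on_lines_mul | apply: poly_on_lines_coord ].
- case=> [[[a b]|[[[a b] c] d]]|[[[[[a b] c] d] e] g]]; rewrite mem_enum unfold_in /=.
  + move=> ab; exists (fun v => (v == a)%:R); rewrite // /f1 /= eqxx.
    by rewrite (eq_sym b) (negPf ab) subr0 oner_eq0.
  + rewrite !inE !negb_or => /and4P [/and3P [ab ac ad] _ _ _].
    exists (fun v => (v == a)%:R); rewrite // /f2 /= eqxx.
    rewrite (eq_sym b) (eq_sym c) (eq_sym d). rewrite (negPf ab) (negPf ac) (negPf ad).
    by rewrite !addr0 subr0 oner_eq0.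
  + rewrite !inE !negb_or => /and5P [/and5P [ab ac ad ae ag] /and4P [bc bd be bg]
       /and3P[cd ce cg] /andP [de dg] /andP [eg _]].
    (* With these values the three points are (0, 0), (1, 0) and (2, 1), whose determinant is -1 in
       every characteristic. *)
    exists (fun v => ((v == c) || (v == e) || (v == g))%:R); rewrite // /f3 /det3 /=.
    rewrite !eqxx !orbT /= !(negPf ac, negPf ae, negPf ag, negPf bc, negPf be, negPf bg).
    rewrite (eq_sym d c) (negPf cd) (negPf de) (negPf dg) /=.
    by rewrite !(mulr0, mul0r, addr0, add0r, subr0, mulr1, oppr0) oppr_eq0 oner_eq0.
exists t; split.
- move=> a b ab; have := ht (inl (inl (a, b))).
  by rewrite mem_enum unfold_in /= ab => /(_ isT); rewrite /f1 /= subr_eq0.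
- move=> a b c d u; have := ht (inl (inr (a, b, c, d))).
  by rewrite mem_enum unfold_in /ok u => /(_ isT); rewrite /f /f2 subr_eq0.
- move=> a b c d e g u; have := ht (inr (a, b, c, d, e, g)).
  by rewrite mem_enum unfold_in /ok u => /(_ isT).
Qed.

End Realisation.

(** * Realising families of lines *)

Section Params.
Variables (T : finType) (F : {set {set T}}).
Hypothesis lin : forall p q l l', p != q -> l \in F -> l' \in F ->
  p \in l -> q \in l -> p \in l' -> q \in l' -> l = l'.
Hypothesis two : forall p, (#|[set l in F | p \in l]| <= 2)%N.

Let V : finType := ({set T} + T * bool)%type.

(* Every point gets two parameters: the lines through it, completed by dummy
   parameters of its own. *)
Definition param1 (p : T) : V :=
  if [pick l in F | p \in l] is Some l then inl l else inr (p, false).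
Definition param2 (p : T) : V :=
  if [pick l in F | (p \in l) && (inl l != param1 p)] is Some l then inl l
  else inr (p, true).
Definition params (p : T) : seq V := [:: param1 p; param2 p].

Lemma param12 p : param1 p != param2 p.
Proof.
rewrite /param2; case: pickP => [l /and3P [_ _]|_]; first by rewrite eq_sym.
by rewrite /param1; case: pickP => *; apply/eqP.
Qed.

(** A line of [F] through [p] that both picks miss would be a third line through [p], against
    [two]. *)
Lemma params_line p l : (inl l \in params p) = (l \in F) && (p \in l).
Proof.
apply/idP/andP => [|[lF pl]].
  rewrite !inE => /orP [] /eqP.
    by rewrite /param1; case: pickP => // l' /andP [? ?] [->].
  by rewrite /param2; case: pickP => // l' /and3P [? ? ?] [->].
rewrite !inE; case: eqP => //= /eqP n1.
rewrite /param2; case: pickP => [l2 /and3P [l2F pl2 n2]|/(_ l)]; last by rewrite lF pl n1.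
case: eqP => // n12; move: n1 n2; rewrite /param1.
case: pickP => [l1 /andP [l1F pl1] n1 n2|/(_ l)]; last by rewrite lF pl.
have := two p; rewrite leqNgt => /negP []; rewrite cardsE.
apply: leq_trans (_ : 3 <= #|[set l1; l2; l]|)%N _.
  rewrite setUC cardsU1 cards2 !inE.
  have -> : (l1 != l2) = true by apply: contra n2 => /eqP ->.
  have -> : (l == l1) = false by apply: contraNF n1 => /eqP ->.
  by case: eqP n12 => // ->.
by apply: subset_leq_card; apply/subsetP => m; rewrite !inE => /orP [/orP []|] /eqP ->;
  apply/andP.
Qed.

Lemma params_fake p q b : inr (q, b) \in params p -> q = p.
Proof.
rewrite !inE => /orP [] /eqP.
  by rewrite /param1; case: pickP => // _ [].
by rewrite /param2; case: pickP => // _ [].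
Qed.

Lemma params_share p q r : p != q -> r \in params p -> r \in params q ->
  exists2 l, r = inl l & [/\ l \in F, p \in l & q \in l].
Proof.
case: r => [l|[s b]] pq.
  by rewrite !params_line => /andP [? ?] /andP [_ ?]; exists l.
by move=> /params_fake sp /params_fake sq; rewrite -sp sq eqxx in pq.
Qed.

Variables (K : fieldType) (t : V -> K).
Hypothesis tinj : forall a b, a != b -> t a != t b.
Hypothesis tsum : forall a b c d, uniq [:: a; b; c; d] -> t a + t b != t c + t d.
Hypothesis tdet : forall a b c d e f, uniq [:: a; b; c; d; e; f] ->
  det3 (t a + t b) (t a * t b) (t c + t d) (t c * t d) (t e + t f) (t e * t f) != 0.

(* The point is the intersection of the tangents to a conic at parameters
   [t (param1 p)] and [t (param2 p)]. *)
Let x p := t (param1 p) + t (param2 p).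
Let z p := t (param1 p) * t (param2 p).

Lemma params_other p r : r \in params p ->
  exists r', [/\ r' \in params p, r != r', x p = t r + t r' & z p = t r * t r'].
Proof.
rewrite !inE => /orP [] /eqP ->.
  by exists (param2 p); rewrite !inE eqxx orbT param12.
exists (param1 p); split; first by rewrite inE eqxx.
- by rewrite eq_sym param12.
- exact: addrC.
- exact: mulrC.
Qed.

(** Dummy parameters belong to one point only, so a shared parameter is a common line, and linearity
    allows just one of these. *)
Lemma params_share1 p q r r' : p != q -> r \in params p -> r \in params q ->
  r' \in params p -> r' \in params q -> r = r'.
Proof.
move=> pq rp rq rp' rq'.
have [l -> [lF pl ql]] := params_share pq rp rq.
have [l' -> [lF' pl' ql']] := params_share pq rp' rq'.
by congr inl; apply: lin pl ql pl' ql'.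
Qed.

(** Both [p] and [q] lie on the tangent with parameter [t r]. The determinant factors into the
    difference of their other parameters and the value at [t r] of the monic quadratic whose roots
    are the parameters of [s]. *)
Lemma params_cdet_share p q s r : p != q -> r \in params p -> r \in params q ->
  r \notin params s -> cdet x z p q s != 0.
Proof.
move=> pq rp rq rs.
have [p' [p'p np xp zp]] := params_other rp.
have [q' [q'q nq xq zq]] := params_other rq.
have pq' : p' != q'.
  by apply: contra np => /eqP e; rewrite (params_share1 pq rp rq p'p) // e.
have -> : cdet x z p q s =
   (t p' - t q') * ((t r - t (param1 s)) * (t r - t (param2 s))).
  by rewrite /cdet xp zp xq zq /x /z /det3; ring.
move: rs; rewrite !inE negb_or => /andP [r1 r2].
by rewrite !mulf_neq0 // subr_eq0 tinj.
Qed.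

Lemma params_disjoint p q : p != q ->
  ~~ has (fun r => r \in params q) (params p) -> uniq (params p ++ params q).
Proof.
move=> pq h; rewrite cat_uniq /= !inE !param12 /= andbT orbF !negb_or.
move: h; rewrite /= !inE !negb_or => /and3P [/andP [a b] /andP [c d] _].
by rewrite ![param1 q == _]eq_sym ![param2 q == _]eq_sym a b c d.
Qed.

(** Points of a line [l] share the parameter [inl l], so they lie on one tangent. Conversely, if two
    of the three points share a parameter, [params_cdet_share] decides whether the third one has it
    too; if no two do, the six parameters are distinct and [tdet] excludes collinearity. *)
Lemma params_realise :
  (forall p q, p != q -> x p != x q) /\
  forall p q s, uniq [:: p; q; s] ->
    (cdet x z p q s = 0 <-> exists2 l, l \in F & [/\ p \in l, q \in l & s \in l]).
Proof.
split=> [p q pq|p q s].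
  have [/hasP [r rp rq]|h] := boolP (has (fun r => r \in params q) (params p)).
    have [p' [p'p np -> _]] := params_other rp.
    have [q' [q'q nq -> _]] := params_other rq.
    rewrite (inj_eq (addrI _)); apply: tinj.
    by apply: contra np => /eqP e; rewrite (params_share1 pq rp rq p'p) // e.
  exact/tsum/(params_disjoint pq h).
rewrite /= !inE negb_or => /and3P [/andP [pq ps] qs _]; split; last first.
  case=> l lF [pl ql sl].
  have lin' u : u \in l -> inl l \in params u by rewrite params_line lF.
  have [p' [_ _ xp zp]] := params_other (lin' _ pl).
  have [q' [_ _ xq zq]] := params_other (lin' _ ql).
  have [s' [_ _ xs zs]] := params_other (lin' _ sl).
  by rewrite /cdet xp zp xq zq xs zs /det3; ring.
move=> d0.
have share u v w r : uniq [:: u; v; w] -> cdet x z u v w = 0 ->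
    r \in params u -> r \in params v ->
    exists2 l, l \in F & [/\ u \in l, v \in l & w \in l].
  move=> uvw d ru rv; move: uvw; rewrite /= !inE negb_or => /and3P [/andP [uv uw] vw _].
  case: (boolP (r \in params w)) => [rw|/(params_cdet_share uv ru rv)]; last by rewrite d eqxx.
  have [l rE [lF ul vl]] := params_share uv ru rv.
  by exists l => //; split=> //; move: rw; rewrite rE params_line => /andP [].
have [/hasP [r rp rq]|hpq] := boolP (has (fun r => r \in params q) (params p)).
  by apply: (share p q s r) => //; rewrite /= !inE negb_or pq ps qs.
have [/hasP [r rp rq]|hqs] := boolP (has (fun r => r \in params s) (params q)).
  have [||l lF [? ? ?]] := share q s p r _ _ rp rq; last by exists l.
    by rewrite /= !inE negb_or qs ![_ == p]eq_sym pq ps.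
  by rewrite cdetR.
have [/hasP [r rp rq]|hps] := boolP (has (fun r => r \in params p) (params s)).
  have [||l lF [? ? ?]] := share s p q r _ _ rp rq; last by exists l.
    by rewrite /= !inE negb_or ![s == _]eq_sym ps qs pq.
  by rewrite -cdetR.
suff /tdet : uniq [:: param1 p; param2 p; param1 q; param2 q; param1 s; param2 s].
  by move: d0; rewrite /cdet /x /z => ->; rewrite eqxx.
rewrite -[X in uniq X]/(params p ++ params q ++ params s).
have := params_disjoint pq hpq; have := params_disjoint qs hqs.
rewrite eq_sym in ps; have := params_disjoint ps hps.
rewrite !cat_uniq has_cat => /and3P [_ h _] /and3P [-> -> ->] /and3P [-> h2 _].
rewrite negb_or h2 !andTb !andbT; apply: contra h => /hasP [r r1 r2].
by apply/hasP; exists r.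
Qed.

End Params.

Lemma realise_lines (K : fieldType) (T : finType) (F : {set {set T}}) :
  infinite_field K ->
  (forall p q l l', p != q -> l \in F -> l' \in F ->
     p \in l -> q \in l -> p \in l' -> q \in l' -> l = l') ->
  (forall p, (#|[set l in F | p \in l]| <= 2)%N) ->
  exists x z : T -> K, injective x /\
    forall p q s, uniq [:: p; q; s] ->
    (cdet x z p q s = 0 <-> exists2 l, l \in F & [/\ p \in l, q \in l & s \in l]).
Proof.
move=> Kinf lin two.
have [t [t1 t2 t3]] := generic_parameters Kinf ({set T} + T * bool)%type.
have [xi h] := params_realise lin two t1 t2 t3.
do 2 eexists; split; last exact: h.
by move=> p q /eqP; apply: contraTeq => /xi.
Qed.

(** * Affine coordinates *)

Section AffinePoints.
Variables (K : fieldType) (vT : vectType K) (e : 3.-tuple vT).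
Hypothesis efree : free e.

(** The value [c = 0] gives the points [Q_j] of [has_coords]; varying [c] moves such a point along
    the line that joins it to the centre of projection. *)
Definition affine_pt (a c : K) : vT := a *: e`_0 + e`_1 + c *: e`_2.

Lemma free_coord3 (a b c : K) :
  a *: e`_0 + b *: e`_1 + c *: e`_2 = 0 -> [/\ a = 0, b = 0 & c = 0].
Proof.
move=> h; have /freeP := efree => /(_ (fun i => nth 0 [:: a; b; c] i)).
rewrite !big_ord_recl big_ord0 /= addr0 addrA => /(_ h) k.
by split; [exact: (k ord0) | exact: (k (lift ord0 ord0)) | exact: (k (lift ord0 (lift ord0 ord0)))].
Qed.

Lemma coord3_eq (a b c a' b' c' : K) :
  a *: e`_0 + b *: e`_1 + c *: e`_2 = a' *: e`_0 + b' *: e`_1 + c' *: e`_2 ->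
  [/\ a = a', b = b' & c = c'].
Proof.
move/eqP; rewrite -subr_eq0 => /eqP h.
have [] := @free_coord3 (a - a') (b - b') (c - c').
  by rewrite -[RHS]h !scalerBl opprD [RHS]addrACA opprD [X in _ = X + _]addrACA.
by do 3![move/eqP; rewrite subr_eq0 => /eqP ->].
Qed.

Lemma scale_affine_pt k a c : k *: affine_pt a c = (k * a) *: e`_0 + k *: e`_1 + (k * c) *: e`_2.
Proof. by rewrite /affine_pt !scalerDr !scalerA. Qed.

Lemma affine_pt_neq0 a c : affine_pt a c != 0.
Proof.
apply/eqP; rewrite -[affine_pt a c]scale1r scale_affine_pt => /free_coord3 [_ /eqP].
by rewrite oner_eq0.
Qed.

Lemma affine_pt_line_inj a c a' c' :
  <[affine_pt a c]>%VS = <[affine_pt a' c']>%VS -> a = a' /\ c = c'.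
Proof.
move=> h; have : affine_pt a c \in <[affine_pt a' c']>%VS by rewrite -h memv_line.
case/vlineP => k; rewrite -[affine_pt a c]scale1r !scale_affine_pt => /coord3_eq [].
by rewrite !mul1r => -> <-; rewrite !mul1r => ->.
Qed.

Lemma affine_pt_free2 a c a' c' : a != a' -> free [:: affine_pt a c; affine_pt a' c'].
Proof.
move=> aa; rewrite free_cons seq1_free affine_pt_neq0 andbT span_seq1.
apply: contra aa => /vlineP [k]; rewrite -[affine_pt a c]scale1r !scale_affine_pt => /coord3_eq [].
by rewrite !mul1r => -> <-; rewrite !mul1r.
Qed.

Lemma affine_pt_free3 a1 c1 a2 c2 a3 c3 : a1 != a2 ->
  free [:: affine_pt a1 c1; affine_pt a2 c2; affine_pt a3 c3] = (det3 a1 c1 a2 c2 a3 c3 != 0).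
Proof.
move=> a12.
rewrite (@perm_free _ _ _ [:: affine_pt a3 c3; affine_pt a1 c1; affine_pt a2 c2]); last first.
  by rewrite (perm_catC [:: _; _] [:: _]).
rewrite free_cons (affine_pt_free2 _ _ a12) andbT; congr (~~ _).
apply/idP/eqP.
  rewrite span_cons span_seq1 => /memv_addP [_ /vlineP [k ->] [_ /vlineP [l ->]]].
  rewrite -[affine_pt a3 c3]scale1r !scale_affine_pt [RHS]addrACA
    [X in _ = X + _]addrACA -!scalerDl.
  case/coord3_eq; rewrite !mul1r => -> h1 ->.
  have -> : k = 1 - l by rewrite h1 addrK.
  by rewrite /det3; ring.
(* The middle coordinates, all equal to 1, force the two coefficients to add up to 1; the first
   coordinates then determine [k]. *)
move=> d0; pose k := (a3 - a2) / (a1 - a2).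
have n12 : a1 - a2 != 0 by rewrite subr_eq0.
have -> : affine_pt a3 c3 = k *: affine_pt a1 c1 + (1 - k) *: affine_pt a2 c2.
  rewrite -[affine_pt a3 c3]scale1r !scale_affine_pt [RHS]addrACA
    [X in _ = X + _]addrACA -!scalerDl.
  congr (_ *: _ + _ *: _ + _ *: _); first by rewrite /k; field.
    by ring.
  have -> : c3 = ((a1 - a3) * c2 - (a2 - a3) * c1) / (a1 - a2).
    apply: (mulIf n12); rewrite divfK // -[LHS]subr0 -d0 /det3; ring.
  by rewrite /k; field.
by rewrite memvD // memvZ // memv_span // !inE eqxx ?orbT.
Qed.

End AffinePoints.

Lemma exists_free3 (K : fieldType) : exists e : 3.-tuple 'cV[K]_3, free e.
Proof.
have h : \dim {:'cV[K]_3} = 3 by rewrite dimvf dim_matrix.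
exists (tcast h (vbasis {:'cV[K]_3})).
by rewrite (_ : tval _ = vbasis {:'cV[K]_3}) ?(basis_free (vbasisP _)) // val_tcast.
Qed.

Lemma free_cV3_size (K : fieldType) (s : seq 'cV[K]_3) : free s -> (size s <= 3)%N.
Proof.
rewrite /free => /eqP <-; apply: leq_trans (dimvS (subvf _)) _.
by rewrite dimvf dim_matrix.
Qed.

(** * Rank-two flats of a simple matroid *)

Section Matroid.
Variable T : finType.
Implicit Types (M : matroid T) (I X l : {set T}).

Lemma leq_mrank M I X : I \in indep M -> I \subset X -> (#|I| <= mrank M X)%N.
Proof.
move=> i s; have P : (I \in indep M) && (I \subset X) by rewrite i.
exact: (leq_bigmax_cond (F := fun J : {set T} => #|J|) I P).
Qed.

Lemma mrank_leqP M X k :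
  reflect (forall I, I \in indep M -> I \subset X -> (#|I| <= k)%N) (mrank M X <= k)%N.
Proof.
by apply: (iffP (bigmax_leqP _ _ _)) => h I;
  [move=> i s; apply: h; rewrite i | case/andP; apply: h].
Qed.

Lemma lt_mrank M X k : (k < mrank M X)%N ->
  exists I, [/\ I \in indep M, I \subset X & (k < #|I|)%N].
Proof.
move=> h; have [/existsP [I /and3P [? ? ?]]|/existsPn no] :=
  boolP [exists I, [&& I \in indep M, I \subset X & (k < #|I|)%N]]; first by exists I.
move: h; rewrite ltnNge => /negP []; apply/mrank_leqP => I Ii IX.
by have := no I; rewrite Ii IX /= -leqNgt.
Qed.

Lemma card_set3 (a b c : T) : uniq [:: a; b; c] -> #|[set a; b; c]| = 3%N.
Proof.
move=> /= /and3P []; rewrite !inE negb_or => /andP [ab ac] bc _.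
by rewrite setUC cardsU1 cards2 ab !inE negb_or ![c == _]eq_sym ac bc.
Qed.

Variable M : matroid T.
Hypothesis simple : simple_matroid M.
Let Ls := lines (matroid_config M).

Lemma line_ground l : l \in Ls -> l \subset ground M.
Proof. by rewrite inE => /and3P [/andP []]. Qed.

Lemma line_card l : l \in Ls -> (3 <= #|l|)%N.
Proof. by rewrite inE => /and3P []. Qed.

Lemma indep_pair a b : a \in ground M -> b \in ground M -> [set a; b] \in indep M.
Proof.
move=> aG bG; apply: simple; first by rewrite subUset !sub1set aG.
by rewrite cards2; case: (a != b).
Qed.

Lemma indep3_notin a b I : a != b -> a \in ground M -> b \in ground M ->
  I \in indep M -> (2 < #|I|)%N ->
  exists c, [/\ c \in I, uniq [:: a; b; c] & [set a; b; c] \in indep M].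
Proof.
move=> ab aG bG Ii cI; have ii := indep_pair aG bG.
have [|y] := indep_aug ii Ii; first by rewrite cards2 ab.
rewrite !inE negb_or setUC => /andP [/andP [ya yb] yI] yi.
by exists y; rewrite /= !inE negb_or ab ![_ == y]eq_sym ya yb.
Qed.

(** A triple inside [l] exceeds the rank of [l]. If [c] is off the flat [l], adding it raises the
    rank to at least three, so the pair [a], [b] can be augmented inside [c |: l]; the new element
    can only be [c]. *)
Lemma line_indep l a b c : l \in Ls -> a \in l -> b \in l -> c \in ground M ->
  uniq [:: a; b; c] -> (c \in l) = ([set a; b; c] \notin indep M).
Proof.
move=> lL al bl cG u; have lG := line_ground lL.
have ab : a != b by case/and3P: u; rewrite inE negb_or => /andP [].
have aG := subsetP lG _ al; have bG := subsetP lG _ bl.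
move: lL; rewrite inE => /and3P [/andP [_ /forall_inP fl] /eqP r2 _].
apply/idP/idP => [cl|].
  apply/negP => i3; have := @leq_mrank M _ l i3; rewrite r2 card_set3 //.
  by rewrite !subUset !sub1set al bl cl => /(_ isT).
apply: contraR => cl; have := fl c; rewrite inE cl cG => /(_ isT).
rewrite r2 => /lt_mrank [I [Ii Is cI]].
have [y [yI uy yi]] := indep3_notin ab aG bG Ii cI.
have := subsetP Is _ yI; rewrite !inE => /orP [/eqP <- //|yl].
have := @leq_mrank M _ l yi; rewrite r2 card_set3 //.
by rewrite !subUset !sub1set al bl yl => /(_ isT).
Qed.

Lemma exists_line a b c : a \in ground M -> b \in ground M -> c \in ground M ->
  uniq [:: a; b; c] -> [set a; b; c] \notin indep M ->
  exists2 l, l \in Ls & [/\ a \in l, b \in l & c \in l].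
Proof.
move=> aG bG cG u nd.
have ab : a != b by case/and3P: u; rewrite inE negb_or => /andP [].
(* This is the closure of [[set a; b]]. The points [a] and [b] are listed apart because for them the
   triple collapses to an independent pair. *)
pose l := [set x in ground M | (x \in [set a; b]) || ([set a; b; x] \notin indep M)].
have al : a \in l by rewrite !inE aG eqxx.
have bl : b \in l by rewrite !inE bG eqxx orbT.
have cl : c \in l by rewrite !inE cG nd !orbT.
exists l => //; rewrite inE; apply/and3P; split.
- apply/andP; split; first by apply/subsetP => x; rewrite inE => /andP [].
  apply/forall_inP => y; rewrite inE => /andP [yl yG].
  have : (mrank M l < 3)%N.
    rewrite ltnS; apply/mrank_leqP => I Ii Il; rewrite leqNgt; apply/negP => cI.
    have [x [xI ux xi]] := indep3_notin ab aG bG Ii cI.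
    have := subsetP Il _ xI; rewrite inE xi /= orbF => /andP [_].
    by rewrite !inE; case/and3P: ux; rewrite !inE negb_or ![_ == x]eq_sym
       => /andP [_ /negPf ->] /negPf ->.
  move=> /leq_trans; apply.
  move: yl; rewrite inE yG /= !inE negb_or negbK => /andP [].
  rewrite negb_or => /andP [ya yb] yi.
  rewrite -(@card_set3 a b y); last by rewrite /= !inE negb_or ab ![_ == y]eq_sym ya yb.
  by apply: leq_mrank yi _; rewrite !subUset !sub1set !in_setU1 al bl eqxx !orbT.
- rewrite eqn_leq; apply/andP; split; last first.
    have := leq_mrank (indep_pair aG bG) (_ : _ \subset l); rewrite cards2 ab; apply.
    by rewrite subUset !sub1set al.
  apply/mrank_leqP => I Ii Il; rewrite leqNgt; apply/negP => cI.
  have [x [xI ux xi]] := indep3_notin ab aG bG Ii cI.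
  have := subsetP Il _ xI; rewrite inE xi /= orbF => /andP [_].
  by rewrite !inE; case/and3P: ux; rewrite !inE negb_or ![_ == x]eq_sym
     => /andP [_ /negPf ->] /negPf ->.
- rewrite -(card_set3 u); apply: subset_leq_card.
  by rewrite !subUset !sub1set al bl cl.
Qed.

Lemma lines_linear p q l l' : p != q -> l \in Ls -> l' \in Ls ->
  p \in l -> q \in l -> p \in l' -> q \in l' -> l = l'.
Proof.
move=> pq lL lL' pl ql pl' ql'; apply/setP => x.
have [->|xp] := eqVneq x p; first by rewrite pl pl'.
have [->|xq] := eqVneq x q; first by rewrite ql ql'.
have [xG|xG] := boolP (x \in ground M).
  have u : uniq [:: p; q; x] by rewrite /= !inE negb_or pq ![_ == x]eq_sym xp xq.
  by rewrite (line_indep lL pl ql xG u) (line_indep lL' pl' ql' xG u).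
have out m : m \in Ls -> (x \in m) = false.
  by move=> mL; apply: contraNF xG; apply: subsetP; apply: line_ground.
by rewrite !out.
Qed.

End Matroid.

(** * Matroids realising families of lines *)

Section VectorMatroid.
Variables (K : fieldType) (T : finType) (d : nat) (v : T -> 'cV[K]_d) (G : {set T}).
Implicit Types A B : {set T}.

Lemma free_enum A (s : seq T) : uniq s -> A =i s ->
  free [seq v x | x <- enum A] = free [seq v x | x <- s].
Proof.
move=> us As; apply/perm_free/perm_map/uniq_perm => //; first exact: enum_uniq.
by move=> x; rewrite mem_enum As.
Qed.

Definition vindep : {set {set T}} :=
  [set A : {set T} | (A \subset G) && free [seq v x | x <- enum A]].

Lemma vindep_sub A : A \in vindep -> A \subset G.
Proof. by rewrite inE => /andP []. Qed.

Lemma vindep0 : set0 \in vindep.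
Proof. by rewrite inE sub0set enum_set0 nil_free. Qed.

Lemma vindepS A B : A \subset B -> B \in vindep -> A \in vindep.
Proof.
move=> AB; rewrite !inE => /andP [BG fB]; rewrite (subset_trans AB BG) /=.
apply: (@catl_free _ _ [seq v x | x <- enum (B :\: A)]); rewrite -map_cat.
rewrite -(free_enum (A := B)) // => [|x].
  rewrite cat_uniq !enum_uniq andbT /=; apply/hasPn => x.
  by rewrite !mem_enum inE => /andP [].
rewrite mem_cat !mem_enum in_setD; case: (boolP (x \in A)) => //= xA.
exact: (subsetP AB).
Qed.

Lemma vindep_aug A B : A \in vindep -> B \in vindep -> (#|A| < #|B|)%N ->
  exists2 x, x \in B :\: A & x |: A \in vindep.
Proof.
rewrite !inE => /andP [AG fA] /andP [BG fB] cAB.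
have [/exists_inP [x xBA xi]|/exists_inPn no] :=
  boolP [exists x in B :\: A, v x \notin <<[seq v y | y <- enum A]>>%VS].
  exists x => //; move: xBA; rewrite !inE => /andP [xA xB].
  rewrite subUset sub1set (subsetP BG _ xB) AG /=.
  rewrite (free_enum (s := x :: enum A)); first by rewrite /= free_cons xi.
    by rewrite /= mem_enum xA enum_uniq.
  by move=> y; rewrite !inE mem_enum.
move: cAB; rewrite ltnNge => /negP []; rewrite !cardE -!(size_map v).
rewrite -(eqP (fB : \dim _ == _)); apply: leq_trans (dim_span _).
apply/dimvS/span_subvP => _ /mapP [x xB ->]; rewrite mem_enum in xB.
have [xA|xA] := boolP (x \in A).
  by apply/memv_span/map_f; rewrite mem_enum.
by have := no x; rewrite inE xA xB negbK => /(_ isT).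
Qed.

Definition vmatroid : matroid T :=
  Matroid vindep_sub vindep0 vindepS vindep_aug.

Lemma vmatroid_realisable : realisable K vmatroid.
Proof. by exists d, v => A /= AG; rewrite inE AG. Qed.

End VectorMatroid.

Section LineFamilies.
Variables (K : fieldType) (T : finType).
Hypothesis Kinf : infinite_field K.
Implicit Types (M N : matroid T) (F : {set {set T}}).

Definition linear_family F := forall p q l l', p != q -> l \in F -> l' \in F ->
  p \in l -> q \in l -> p \in l' -> q \in l' -> l = l'.

Definition at_most_two_lines F := forall p : T, (#|[set l in F | p \in l]| <= 2)%N.

Definition collinear F (p q r : T) := [exists l in F, [&& p \in l, q \in l & r \in l]].

Lemma collinearP F p q r :
  reflect (exists2 l, l \in F & [/\ p \in l, q \in l & r \in l]) (collinear F p q r).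
Proof.
apply: (iffP exists_inP) => [[l lF /and3P [? ? ?]]|[l lF [? ? ?]]]; exists l => //.
exact/and3P.
Qed.

(** The matroid is that of the homogeneous coordinates of a realisation of [F] in the plane. The
    given noncollinear triple makes its rank three. *)
Lemma matroid_of_family F (G : {set T}) :
  linear_family F -> at_most_two_lines F -> (forall l, l \in F -> l \subset G) ->
  (exists a b c, [/\ uniq [:: a; b; c], [set a; b; c] \subset G & ~~ collinear F a b c]) ->
  exists N, [/\ admissible K N, ground N = G &
    forall a b c, uniq [:: a; b; c] -> [set a; b; c] \subset G ->
      ([set a; b; c] \in indep N) = ~~ collinear F a b c].
Proof.
move=> lin two FG [a0 [b0 [c0 [u0 s0 nc0]]]].
have [x [z [xi xz]]] := realise_lines Kinf lin two.
have [e fe] := exists_free3 K.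
pose v p := affine_pt e (x p) (z p).
pose N := vmatroid v G.
have N3 a b c : uniq [:: a; b; c] -> [set a; b; c] \subset G ->
    ([set a; b; c] \in indep N) = ~~ collinear F a b c.
  move=> u sG; rewrite inE sG (free_enum v u); last first.
    by move=> y; rewrite !inE orbA.
  have ab : x a != x b by rewrite (inj_eq xi); case/and3P: u; rewrite inE negb_or => /andP [].
  rewrite /= (affine_pt_free3 fe _ _ _ _ ab); congr (~~ _).
  apply/eqP/collinearP; first by move/(xz _ _ _ u).
  by move=> h; apply/(xz _ _ _ u).
have Nsimple : simple_matroid N.
  move=> A AG cA; rewrite inE AG /=.
  case: (posnP #|A|) => [/eqP|A0].
    by rewrite cards_eq0 => /eqP ->; rewrite enum_set0 nil_free.
  have [/eqP/cards1P [p ->]|A2] := eqVneq #|A| 1%N.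
    by rewrite enum_set1 /= seq1_free affine_pt_neq0.
  have /cards2P [p [q [pq ->]]] : #|A| == 2 by rewrite eqn_leq cA ltn_neqAle eq_sym A2.
  rewrite (free_enum v (s := [:: p; q])) /= ?inE ?pq // => [|y]; last by rewrite !inE.
  by apply: affine_pt_free2 => //; rewrite (inj_eq xi).
exists N; split=> //; split=> //.
- apply/eqP; rewrite eqn_leq; apply/andP; split.
    apply/mrank_leqP => I; rewrite inE => /andP [_ fI] _.
    by rewrite cardE -(size_map v); apply: free_cV3_size.
  by rewrite -(card_set3 u0); apply: leq_mrank => //; rewrite N3.
(* Every line of [N] turns out to be a member of [F]: it is determined by two of its points, and a
   third one provides the member. So the bound for [F] carries over. *)
- move=> p _; apply: leq_trans (two p); apply: subset_leq_card.
  apply/subsetP => l; rewrite in_set => /andP [lN pl]; rewrite in_set pl andbT.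
  have lG := line_ground lN.
  have /set0Pn [q] : l :\ p != set0.
    by rewrite -card_gt0; have := line_card lN; rewrite (cardsD1 p) pl => /ltnW.
  rewrite !inE => /andP [qp ql].
  have /set0Pn [r] : l :\ p :\ q != set0.
    rewrite -card_gt0; have := line_card lN; rewrite (cardsD1 p) pl (cardsD1 q) !inE.
    by rewrite qp ql.
  rewrite !inE => /and3P [rq rp rl].
  have col s : s \in G -> s != p -> s != q -> (s \in l) = collinear F p q s.
    move=> sG sp sq.
    have u : uniq [:: p; q; s] by rewrite /= !inE negb_or ![p == _]eq_sym qp sp eq_sym sq.
    rewrite (line_indep Nsimple lN pl ql sG u) N3 ?negbK //.
    by rewrite !subUset !sub1set sG !(subsetP lG).
  have := rl; rewrite (col r) ?(subsetP lG) // => /collinearP [l' lF' [pl' ql' rl']].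
  suff -> : l = l' by [].
  apply/setP => s.
  have [->|sp] := eqVneq s p; first by rewrite pl pl'.
  have [->|sq] := eqVneq s q; first by rewrite ql ql'.
  have [sG|sG] := boolP (s \in G); last first.
    by rewrite (contraNF (subsetP lG s) sG) (contraNF (subsetP (FG _ lF') s) sG).
  rewrite (col s) //; apply/collinearP/idP => [[m mF [pm qm sm]]|sl']; last by exists l'.
  by rewrite -(lin p q m l') // eq_sym.
- exact: vmatroid_realisable.
Qed.

(** This is the only way in which maximality is used. A family [F] coarser than the lines of [M]
    defines an admissible matroid above [M], so maximality makes each of its dependent triples
    dependent in [M]. A degeneration that creates a new collinear triple is therefore a
    contradiction. *)
Lemma maximal_extension M F :
  maximal_matroid K M ->
  linear_family F -> at_most_two_lines F -> (forall l, l \in F -> l \subset ground M) ->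
  (forall l, l \in lines (matroid_config M) -> exists2 l', l' \in F & l \subset l') ->
  (exists a b c, [/\ uniq [:: a; b; c], [set a; b; c] \subset ground M & ~~ collinear F a b c]) ->
  forall l a b c, l \in F -> a \in l -> b \in l -> c \in l -> uniq [:: a; b; c] ->
    collinear (lines (matroid_config M)) a b c.
Proof.
move=> [[Msimple rM _ _] Mmax] lin two FG ML ex l a b c lF al bl cl u.
have [N [adN gN N3]] := matroid_of_family lin two FG ex.
have [|_ h] := Mmax N adN.
  split=> // A /andP [AG Ai]; rewrite /dependent gN AG /=.
  have [cA|cA] := leqP #|A| 2; first by rewrite Msimple in Ai.
  have [Nsimple rN _ _] := adN.
  (* The rank of [N] leaves only triples to exclude; a dependent triple of [M] lies on a line of
     [M], hence inside a member of [F]. *)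
  apply/negP => Ai'.
  have A3 : #|A| = 3%N.
    by apply/eqP; rewrite eqn_leq cA -rN leq_mrank ?gN.
  have /set0Pn [p pA] : A != set0 by rewrite -card_gt0 A3.
  have : #|A :\ p| == 2 by move/eqP: A3; rewrite (cardsD1 p) pA.
  case/cards2P => q [r [qr Ar]].
  have AE : A = [set p; q; r] by rewrite -setUA -Ar setD1K.
  have upqr : uniq [:: p; q; r].
    have : p \notin [set q; r] by rewrite -Ar !inE eqxx.
    by rewrite /= !inE => ->; rewrite qr.
  have := AG; rewrite AE !subUset !sub1set => /andP [/andP [pG qG] rG].
  have [|m mL [pm qm rm]] := exists_line Msimple pG qG rG upqr; first by rewrite -AE.
  have [m' mF mm] := ML m mL.
  move: Ai'; rewrite AE N3 -?AE // => /negP []; apply/collinearP.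
  by exists m' => //; rewrite !(subsetP mm).
have sG : [set a; b; c] \subset ground M.
  by rewrite !subUset !sub1set !(subsetP (FG _ lF)).
have /h : dependent N [set a; b; c].
  rewrite /dependent gN sG N3 //= negbK; apply/collinearP; by exists l.
case/andP => _ nd; move: sG; rewrite !subUset !sub1set => /andP [/andP [aG bG] cG].
exact/collinearP/exists_line.
Qed.

End LineFamilies.

(** * Maximal matroids *)

Lemma uniq3 (T : eqType) (a b c : T) : a != b -> a != c -> b != c -> uniq [:: a; b; c].
Proof. by move=> ab ac bc; rewrite /= !inE negb_or ab ac bc. Qed.

(** * Vectors that lift a family of lines *)

Section Lifts.
Variables (K : fieldType) (T : finType).
Implicit Types (x z : T -> K) (S : {set {set T}}).

Definition lifts S x z :=
  forall l i j k, l \in S -> i \in l -> j \in l -> k \in l -> cdet x z i j k = 0.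

Lemma cdet_not_uniq x z i j k : ~~ uniq [:: i; j; k] -> cdet x z i j k = 0.
Proof.
rewrite /= !inE andbT negb_and !negbK /cdet /det3.
by case/orP => [/orP [] |] /eqP ->; ring.
Qed.

(** On a line the values [z] are an affine function of the values [x], so two zeros force all the
    others. *)
Lemma lifts_zero S x z l a b c : injective x -> lifts S x z -> l \in S ->
  a \in l -> b \in l -> a != b -> z a = 0 -> z b = 0 -> c \in l -> z c = 0.
Proof.
move=> xi Lz lS al bl ab za zb cl; have := Lz l a b c lS al bl cl.
rewrite /cdet /det3 za zb !mulr0 subrr add0r => /eqP.
by rewrite mulf_eq0 subr_eq0 (inj_eq xi) (negPf ab) => /eqP.
Qed.

Lemma cdet_affine x z (c a b : K) i j k :
  cdet x (fun y => c * z y + a * x y + b) i j k = c * cdet x z i j k.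
Proof. by rewrite /cdet /det3; ring. Qed.

(** The nonzero determinant says that the functions 1, [x] and [z] are independent on the three
    points. The coefficient [c] comes from Cramer's rule, and [d1], [d0] interpolate the remainder
    at [o] and [a]. *)
Lemma interpolate x z w o a b : x o != x a -> cdet x z o a b != 0 ->
  exists c d1 d0, forall q, q \in [:: o; a; b] -> w q = c * z q + d1 * x q + d0.
Proof.
rewrite /cdet => oa D.
pose c := det3 (x o) (w o) (x a) (w a) (x b) (w b) /
          det3 (x o) (z o) (x a) (z a) (x b) (z b).
pose d1 := ((w a - c * z a) - (w o - c * z o)) / (x a - x o).
have n : x a - x o != 0 by rewrite subr_eq0 eq_sym.
exists c, d1, (w o - c * z o - d1 * x o) => q; rewrite !inE => /or3P [] /eqP ->.
- by ring.
- by rewrite /d1; field.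
- have cE : c * det3 (x o) (z o) (x a) (z a) (x b) (z b) =
            det3 (x o) (w o) (x a) (w a) (x b) (w b) by rewrite divfK.
  have n' : x o - x a != 0 by rewrite subr_eq0.
  apply: (mulfI n'); rewrite -[LHS]subr0 -(subrr (det3 (x o) (w o) (x a) (w a) (x b) (w b))).
  by rewrite -{2}cE /d1 /det3; field.
Qed.

End Lifts.

(** * Degenerations of a maximal matroid *)

Section MaximalStructure.
Variables (K : fieldType) (T : finType) (M : matroid T) (F : {set {set T}}).
Hypothesis Kinf : infinite_field K.
Hypothesis Mmax : maximal_matroid K M.
Hypothesis FE : lines (matroid_config M) = F.
Let A := ground M.
Hypothesis cover_lines : cover F = A.

Let Msimple : simple_matroid M.
Proof. by case: Mmax => [[]]. Qed.

Let lin : linear_family F.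
Proof. by rewrite -FE; exact: lines_linear. Qed.

Let lineA l : l \in F -> l \subset A.
Proof. by rewrite -FE => /line_ground. Qed.

Let line3 l : l \in F -> (2 < #|l|)%N.
Proof. by rewrite -FE => /line_card. Qed.

Let two : at_most_two_lines F.
Proof.
move=> p; have [pA|pA] := boolP (p \in A).
  by case: Mmax => [[_ _ h _] _]; rewrite -FE; apply: h.
rewrite (_ : [set _ in _ | _] = set0) ?cards0 //; apply/setP => l; rewrite in_set in_set0.
by apply: contraNF pA => /andP [lF pl]; apply: subsetP (lineA lF) _ pl.
Qed.

Let no_three p l1 l2 l3 : l1 \in F -> l2 \in F -> l3 \in F -> p \in l1 -> p \in l2 ->
  p \in l3 -> ~~ uniq [:: l1; l2; l3].
Proof.
move=> h1 h2 h3 p1 p2 p3; apply/negP => /card_set3 c.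
have := two p; rewrite leqNgt -c subset_leq_card //.
by rewrite !subUset !sub1set !in_set h1 h2 h3 p1 p2 p3.
Qed.

Let ext F' := @maximal_extension K T Kinf M F' Mmax.

Let line_minus l l' : l \in F -> l' \in F -> l != l' ->
  exists p q, [/\ p != q, p \in l :\: l' & q \in l :\: l'].
Proof.
move=> lF lF' ll.
have /card_gt1P [p [q [pl ql pq]]] : (1 < #|l :\: l'|)%N; last by exists p, q.
have h : (#|l :&: l'| <= 1)%N.
  rewrite leqNgt; apply/negP => /card_gt1P [p [q []]].
  rewrite !inE => /andP [pl pl'] /andP [ql ql'] pq.
  by move: ll; rewrite (lin pq lF lF' pl ql pl' ql') eqxx.
have := line3 lF; rewrite -(cardsID l' l).
by move: h; case: #|l :&: l'| => [|[|]] // _ /ltnW.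
Qed.

Let line_points l : l \in F -> exists p q, [/\ p != q, p \in l & q \in l].
Proof. by move=> /line3/ltnW/card_gt1P [p [q [? ? ?]]]; exists p, q. Qed.

Let line_other l p : l \in F -> exists2 q, q \in l & q != p.
Proof.
case/line_points => q [r [qr ql rl]]; have [e|] := eqVneq q p; last by exists q.
by exists r => //; rewrite -e eq_sym.
Qed.

(* Otherwise the lines of [S] could be merged into a single one. *)
Lemma maximal_merge (S : {set {set T}}) : S \proper F -> (1 < #|S|)%N ->
  exists2 w, w \in F :\: S & (1 < #|w :&: cover S|)%N.
Proof.
move=> /properP [SF [w0 w0F w0S]] S2.
have [/exists_inP [w]|/exists_inPn no] :=
  boolP [exists w in F :\: S, (1 < #|w :&: cover S|)%N]; first by exists w.
exfalso; pose U := cover S.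
have inU s p : s \in S -> p \in s -> p \in U by move=> sS ps; apply/bigcupP; exists s.
have once w p q : w \in F -> w \notin S -> p != q -> p \in w -> q \in w ->
    p \in U -> q \in U -> False.
  move=> wF wS pq pw qw pU qU; have := no w; rewrite inE wF wS => /(_ isT) /negP; apply.
  by apply/card_gt1P; exists p, q; rewrite !in_setI pw qw pU qU.
have /card_gt1P [l1 [l2 [l1S l2S l12]]] := S2.
have l1F := subsetP SF _ l1S; have l2F := subsetP SF _ l2S.
pose F' := U |: (F :\: S).
have F'P l : l \in F' -> l = U \/ l \in F /\ l \notin S.
  by rewrite in_setU1 in_setD => /orP [/eqP|/andP [? ?]]; [left | right].
have [a [b [ab al1 bl1]]] := line_points l1F.
have l21 : l2 != l1 by rewrite eq_sym.
(* The points [a], [b], [c] all lie on the merged line [U], while [c] is off [l1], the only line of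
   [F] through [a] and [b]. *)
have [c [_ [_ cl _]]] := line_minus l2F l1F l21.
move: cl; rewrite in_setD => /andP [cl1 cl2].
have : collinear F a b c.
  rewrite -FE; apply: (ext (F' := F')) (inU _ _ l1S al1) (inU _ _ l1S bl1) (inU _ _ l2S cl2) _.
  - move=> p q l l' pq /F'P [->|[lF lS]] /F'P [->|[lF' lS']] // pl ql pl' ql'.
    + by case: (once l' p q).
    + by case: (once l p q).
    + exact: lin pq lF lF' pl ql pl' ql'.
  (* At a point of [U] the new line replaces at least one line [s] of [S], so the number of lines
     through it does not grow. *)
  - move=> p; have [/bigcupP [s sS ps]|pU] := boolP (p \in U).
      have sF := subsetP SF _ sS.
      have : (#|U |: ([set l in F | p \in l] :\ s)| <= 2)%N.
        rewrite cardsU1; have := two p; rewrite (cardsD1 s) in_set sF ps.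
        by case: (U \notin _) => //= /ltnW.
      apply: leq_trans; apply: subset_leq_card; apply/subsetP => l.
      rewrite in_set => /andP [/F'P [->|[lF lS]] pl]; rewrite in_setU1 ?eqxx // in_setD1 in_set.
      by rewrite lF pl (_ : l != s) ?orbT //; apply: contraNneq lS => ->.
    apply: leq_trans (two p); apply: subset_leq_card; apply/subsetP => l.
    rewrite in_set => /andP [/F'P [->|[lF _]] pl]; first by rewrite pl in pU.
    by rewrite in_set lF.
  - move=> l /F'P [->|[/lineA]] //; apply/bigcupsP => s sS.
    by apply: lineA; apply: subsetP SF _ sS.
  - move=> l; rewrite FE => lF; have [lS|lS] := boolP (l \in S); last first.
      by exists l; rewrite // in_setU1 in_setD lF lS orbT.
    by exists U; rewrite ?in_setU1 ?eqxx //; apply: bigcup_sup.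
  (* The merged family still has a noncollinear triple: two points of [w0] outside [U], and a point
     of [l1] off [w0]. *)
  - have [p [q [pq pw qw]]] : exists p q, [/\ p != q, p \in w0 :\: U & q \in w0 :\: U].
      have /card_gt1P [p [q [pw qw pq]]] : (1 < #|w0 :\: U|)%N; last by exists p, q.
      have := no w0; rewrite inE w0F w0S -leqNgt => /(_ isT) h.
      have := line3 w0F; rewrite -(cardsID U w0).
      by move: h; case: #|w0 :&: U| => [|[|]] // _ /ltnW.
    have l1w : l1 != w0 by apply: contraNneq w0S => <-.
    have [r [_ [_ rl _]]] := line_minus l1F w0F l1w.
    move: pw qw rl; rewrite !in_setD => /andP [pU pw] /andP [qU qw] /andP [rw rl].
    have rU := inU _ _ l1S rl.
    exists p, q, r; split.
    + by apply: uniq3 => //; [apply: contraNneq pU => -> | apply: contraNneq qU => ->].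
    + rewrite !subUset !sub1set (subsetP (lineA w0F) _ pw) (subsetP (lineA w0F) _ qw) /=.
      exact: (subsetP (lineA l1F) _ rl).
    + apply/negP => /collinearP [l /F'P [->|[lF lS]] [pl ql rl']]; first by rewrite pl in pU.
      by move: rw; rewrite -(lin pq lF w0F pl ql pw qw) rl'.
  - by rewrite /F' in_setU1 eqxx.
  - by apply: uniq3 => //; apply: contraNneq cl1 => <-.
case/collinearP => l lF [al bl cl].
by move: cl1; rewrite -(lin ab lF l1F al bl al1 bl1) cl.
Qed.

(* Otherwise [p] could be moved to the intersection of [v] and [u]. *)
Lemma maximal_pendant u v p : u \in F -> v \in F -> p \in v ->
  (forall l, l \in F -> p \in l -> l = v) -> ~~ [disjoint u & v].
Proof.
move=> uF vF pv pl; apply/negP => duv.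
have uvF q : q \in u -> q \in v -> False.
  by move=> qu qv; move/pred0P: duv => /(_ q) /=; rewrite qu qv.
have pu : p \notin u by apply/negP => /uvF; apply.
(* As [p] lies on [v] alone, it ends up on the two lines [U] and [v]; as [u] and [v] are disjoint,
   these meet only in [p], so linearity survives. *)
pose U := p |: u; pose F' := U |: (F :\ u).
have F'P l : l \in F' -> l = U \/ l \in F /\ l != u.
  by rewrite in_setU1 in_setD1 => /orP [/eqP|/andP [? ?]]; [left | right].
have UP q l : q \in U -> l \in F -> q \in l -> l != v -> q \in u.
  by rewrite in_setU1 => /orP [/eqP -> /pl h /h ->|]; rewrite ?eqxx.
have once l a b : a != b -> l \in F -> l != u -> a \in U -> b \in U ->
    a \in l -> b \in l -> False.
  move=> ab lF lu aU bU al bl; have [lv|lv] := eqVneq l v.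
    move: aU bU ab; rewrite !in_setU1 => /orP [/eqP ->|/uvF]; last by case; rewrite -lv.
    by move=> /orP [/eqP ->|/uvF]; [rewrite eqxx | case; rewrite -lv].
  by move: lu; rewrite (lin ab lF uF al bl (UP _ _ aU lF al lv) (UP _ _ bU lF bl lv)) eqxx.
have [a [b [ab au bu]]] := line_points uF.
have uU q : q \in u -> q \in U by rewrite in_setU1 => ->; rewrite orbT.
have : collinear F p a b.
  rewrite -FE; apply: (ext (F' := F')) (_ : p \in U) (uU _ au) (uU _ bu) _.
  - move=> q r l l' qr /F'P [->|[lF lS]] /F'P [->|[lF' lS']] // ql rl ql' rl'.
    + by case: (once l' q r).
    + by case: (once l q r).
    + exact: lin qr lF lF' ql rl ql' rl'.
  - move=> q; have [->|qp] := eqVneq q p.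
      apply: leq_trans (_ : #|[set U; v]| <= _)%N; last by rewrite cards2; case: (_ != _).
      apply: subset_leq_card; apply/subsetP => l.
      rewrite in_set => /andP [/F'P [->|[lF _]] ql]; first by rewrite set21.
      by rewrite (pl l) ?set22.
    have [qu|qu] := boolP (q \in u).
      have : (#|U |: ([set l in F | q \in l] :\ u)| <= 2)%N.
        rewrite cardsU1; have := two q; rewrite (cardsD1 u) in_set uF qu.
        by case: (U \notin _) => //= /ltnW.
      apply: leq_trans; apply: subset_leq_card; apply/subsetP => l.
      rewrite in_set => /andP [/F'P [->|[lF lS]] ql]; rewrite in_setU1 ?eqxx // in_setD1 in_set.
      by rewrite lF ql lS orbT.
    apply: leq_trans (two q); apply: subset_leq_card; apply/subsetP => l.
    rewrite in_set => /andP [/F'P [->|[lF _]] ql]; last by rewrite in_set lF.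
    by move: ql; rewrite in_setU1 (negPf qp) (negPf qu).
  - move=> l /F'P [->|[/lineA]] //; rewrite subUset sub1set (lineA uF) andbT.
    exact: subsetP (lineA vF) _ pv.
  - move=> l; rewrite FE => lF; have [->|lu] := eqVneq l u.
      by exists U; rewrite ?in_setU1 ?eqxx // subsetU // subxx orbT.
    by exists l; rewrite // in_setU1 in_setD1 lF lu orbT.
  - have uv : u != v by apply: contraNneq pu => ->.
    have vu : v != u by rewrite eq_sym.
    have : (1 < #|v :\ p|)%N by have := line3 vF; rewrite (cardsD1 p) pv.
    case/card_gt1P => q [r []]; rewrite !in_setD1 => /andP [qp qv] /andP [rp rv] qr.
    exists q, r, a; split.
    + by apply: uniq3 => //; apply/eqP => e; apply: (uvF a) => //; rewrite -e.
    + rewrite !subUset !sub1set (subsetP (lineA vF) _ qv) (subsetP (lineA vF) _ rv) /=.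
      exact: (subsetP (lineA uF) _ au).
    + apply/negP => /collinearP [l /F'P [->|[lF lS]] [ql rl al]].
        by move: ql; rewrite in_setU1 (negPf qp) => /uvF; apply.
      by apply: (uvF a) => //; rewrite -(lin qr lF vF ql rl qv rv).
  - by rewrite /F' in_setU1 eqxx.
  - by rewrite setU11.
  - by apply: uniq3 => //; apply: contraNneq pu => ->.
case/collinearP => l lF [pl' al bl]; apply: (uvF a) => //.
by rewrite -(pl l).
Qed.

(* Otherwise [p1], [p2], [p3] could be made collinear. *)
Lemma maximal_transversal l1 l2 l3 p1 p2 p3 : uniq [:: l1; l2; l3] ->
  l1 \in F -> l2 \in F -> l3 \in F -> p1 \in l1 -> p2 \in l2 -> p3 \in l3 ->
  (forall l, l \in F -> p1 \in l -> l = l1) ->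
  (forall l, l \in F -> p2 \in l -> l = l2) ->
  (forall l, l \in F -> p3 \in l -> l = l3) -> False.
Proof.
rewrite /= !inE negb_or => /and3P [/andP [l12 l13] l23 _] l1F l2F l3F p1l p2l p3l u1 u2 u3.
(* Each of the three points lies on a single line, so the new line [t] gives it at most two, and no
   old line contains two of them. *)
pose t := [set p1; p2; p3]; pose F' := t |: F.
have F'P l : l \in F' -> l = t \/ l \in F.
  by rewrite in_setU1 => /orP [/eqP|?]; [left | right].
have once l a b : a != b -> l \in F -> a \in t -> b \in t -> a \in l -> b \in l -> False.
  move=> ab lF; rewrite !inE -!orbA => /or3P at_ /or3P bt al bl; move: l12 l13 l23.
  by case: at_ bt => /eqP ea [] /eqP eb; rewrite ?ea ?eb in ab al bl;
    first [ by rewrite eqxx in ab | rewrite -(u1 l lF al) -(u2 l lF bl) eqxx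
          | rewrite -(u2 l lF al) -(u1 l lF bl) eqxx | rewrite -(u1 l lF al) -(u3 l lF bl) eqxx
          | rewrite -(u3 l lF al) -(u1 l lF bl) eqxx | rewrite -(u2 l lF al) -(u3 l lF bl) eqxx
          | rewrite -(u3 l lF al) -(u2 l lF bl) eqxx ].
have p12 : p1 != p2 by apply: contraNneq l12 => e; rewrite -(u2 l1) // -e.
have p13 : p1 != p3 by apply: contraNneq l13 => e; rewrite -(u3 l1) // -e.
have p23 : p2 != p3 by apply: contraNneq l23 => e; rewrite -(u3 l2) // -e.
have : collinear F p1 p2 p3.
  rewrite -FE; apply: (ext (F' := F')) (_ : p1 \in t) (_ : p2 \in t) (_ : p3 \in t) _.
  - move=> q r l l' qr /F'P [->|lF] /F'P [->|lF'] // ql rl ql' rl'.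
    + by case: (once l' q r).
    + by case: (once l q r).
    + exact: lin qr lF lF' ql rl ql' rl'.
  - move=> q; have [qt|qt] := boolP (q \in t).
      have [m hm] : exists m, forall l, l \in F -> q \in l -> l = m.
        by move: qt; rewrite !inE -!orbA => /or3P [] /eqP ->; [exists l1|exists l2|exists l3].
      apply: leq_trans (_ : #|[set t; m]| <= _)%N; last by rewrite cards2; case: (_ != _).
      apply: subset_leq_card; apply/subsetP => l.
      rewrite in_set => /andP [/F'P [->|lF] ql]; first by rewrite set21.
      by rewrite (hm l) ?set22.
    apply: leq_trans (two q); apply: subset_leq_card; apply/subsetP => l.
    by rewrite in_set => /andP [/F'P [->|lF] ql]; [rewrite ql in qt | rewrite in_set lF].
  - move=> l /F'P [->|/lineA] //; rewrite !subUset !sub1set.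
    by rewrite (subsetP (lineA l1F)) // (subsetP (lineA l2F)) // (subsetP (lineA l3F)).
  - by move=> l; rewrite FE => lF; exists l; rewrite // in_setU1 lF orbT.
  - have [a al ap] := line_other p1 l1F.
    have uniq_a : uniq [:: p1; a; p2].
      apply: uniq3 => //; first by rewrite eq_sym.
      by apply: contraNneq l12 => e; rewrite -(u2 l1) // -e.
    exists p1, a, p2; split=> //.
      rewrite !subUset !sub1set (subsetP (lineA l1F) _ p1l) (subsetP (lineA l1F) _ al) /=.
      exact: (subsetP (lineA l2F) _ p2l).
    apply/negP => /collinearP [l /F'P [->|lF] [pl al' p2l']].
      by case: (once l1 p1 a); rewrite // 1?eq_sym // !inE eqxx.
    by move: l12; rewrite -(u1 l) // -(u2 l) // eqxx.
  - by rewrite /F' in_setU1 eqxx.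
  - by rewrite !inE eqxx.
  - by rewrite !inE eqxx orbT.
  - by rewrite !inE eqxx orbT.
  - exact: uniq3.
by case/collinearP => l lF [pl al bl]; move: l12; rewrite -(u1 l) // -(u2 l) // eqxx.
Qed.

(** A line has rank two and cannot be the whole ground set, which is covered by lines; a point off
    one line gives another. *)
Lemma lines_gt1 : (1 < #|F|)%N.
Proof.
have [[_ rA _ _] _] := Mmax.
have [l lF] : exists l, l \in F.
  have [I [Ii IA cI]] : exists I, [/\ I \in indep M, I \subset A & (2 < #|I|)%N].
    by apply: lt_mrank; rewrite rA.
  have /set0Pn [p pI] : I != set0 by rewrite -card_gt0 ltnW // ltnW.
  have := subsetP IA _ pI; rewrite -cover_lines => /bigcupP [l lF _]; by exists l.
have [p pA pl] : exists2 p, p \in A & p \notin l.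
  apply/subsetPn/negP => Al.
  have /eqP e : l == A by rewrite eqEsubset lineA.
  by move: lF; rewrite -FE inE e rA => /and3P [].
move: pA; rewrite -cover_lines => /bigcupP [m mF pm].
apply/card_gt1P; exists l, m; split=> //; apply: contraNneq pl => ->; exact: pm.
Qed.

(** Suppose that two lines are disjoint. If there are no others, every point of [l2] lies on [l2]
    only, and [maximal_pendant] is contradicted. Otherwise [maximal_merge] yields a further line
    that meets one of them. *)
Lemma lines_meet :
  exists l1 l2 o, [/\ l1 != l2, l1 \in F, l2 \in F, o \in l1 & o \in l2].
Proof.
have /card_gt1P [l1 [l2 [l1F l2F l12]]] := lines_gt1.
have [d|/pred0Pn [o /andP [o1 o2]]] := boolP [disjoint l1 & l2]; last by exists l1, l2, o.
have sF : [set l1; l2] \subset F by rewrite subUset !sub1set l1F.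
have [FS|pF] := eqVproper sF.
  have [p [_ [_ pl _]]] := line_points l2F.
  suff /(maximal_pendant l1F l2F pl) : forall l, l \in F -> p \in l -> l = l2 by rewrite d.
  move=> l; rewrite -FS => /set2P [->|] // pl1.
  by move/pred0P: d => /(_ p); rewrite /= pl pl1.
have [|w] := maximal_merge pF; first by rewrite cards2 l12.
rewrite in_setD => /andP [wS wF] /card_gt1P [p [_ [pU _ _]]].
move: pU; rewrite inE => /andP [pw /bigcupP [s sS ps]].
exists s, w, p; split=> //; last exact: subsetP sF _ sS.
by apply: contraNneq wS => <-.
Qed.

(** * Bounds on the kernel of a maximal matroid *)

Section Grow.
Variables l1 l2 : {set T}.
Hypotheses (l12 : l1 != l2) (l1F : l1 \in F) (l2F : l2 \in F).

(** While lines are missing, [maximal_merge] gives one with two points on the lines already reached,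
    and [z] vanishes on it by [lifts_zero]. The count [m] is free so that the growth can stop one
    line before the end, as [kernel_le2] requires. *)
Lemma grow_lines m : (2 <= m <= #|F|)%N ->
  exists S : {set {set T}}, [/\ S \subset F, l1 \in S, l2 \in S, #|S| = m &
    forall (x z : T -> K), injective x -> lifts S x z ->
      (forall i, i \in l1 -> z i = 0) -> (forall i, i \in l2 -> z i = 0) ->
      forall i, i \in cover S -> z i = 0].
Proof.
elim: m => [//|m IH]; rewrite ltnS leq_eqVlt => /andP [/orP [/eqP <- _|m2 mF]].
  exists [set l1; l2]; rewrite set21 set22 cards2 l12 subUset !sub1set l1F l2F.
  by split=> // x z _ _ h1 h2 i /bigcupP [s /set2P [] ->]; [apply: h1 | apply: h2].
have [|S [SF l1S l2S cS det]] := IH; first by rewrite m2 ltnW.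
have [||w] := @maximal_merge S; last 1 first.
- rewrite in_setD => /andP [wS wF] /card_gt1P [p [q []]].
  rewrite !in_setI => /andP [pw pU] /andP [qw qU] pq.
  exists (w |: S); split.
  + by rewrite subUset sub1set wF.
  + by rewrite in_setU1 l1S orbT.
  + by rewrite in_setU1 l2S orbT.
  + by rewrite cardsU1 wS cS.
  move=> x z xi L h1 h2 i /bigcupP [s]; have {}det : forall i, i \in cover S -> z i = 0.
    apply: det xi _ h1 h2 => l a b c lS; apply: L; by rewrite in_setU1 lS orbT.
  rewrite in_setU1 => /orP [/eqP -> iw|sS si]; last by apply: det; apply/bigcupP; exists s.
  by apply: (lifts_zero xi L (setU11 _ _) pw qw pq) => //; apply: det.
- by rewrite properEcard SF cS.
- by rewrite cS.
Qed.

End Grow.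

(** Zeros at the meeting point of two lines and at one more point of each spread over both lines,
    and then over all the others by [grow_lines]. *)
Lemma kernel_le3 : exists2 B : {set T}, (#|B| <= 3)%N &
  forall x z : T -> K, injective x -> lifts F x z ->
    (forall b, b \in B -> z b = 0) -> forall i, i \in A -> z i = 0.
Proof.
have [l1 [l2 [o [l12 l1F l2F ol1 ol2]]]] := lines_meet.
have [a al1 ao] := line_other o l1F; have [b bl2 bo] := line_other o l2F.
exists [set o; a; b].
  by rewrite setUC cardsU1 cards2; case: (_ \notin _); case: (_ != _).
move=> x z xi L h; have [|S [SF l1S l2S cS det]] := @grow_lines _ _ l12 l1F l2F #|F|.
  by rewrite lines_gt1 leqnn.
have SE : S = F by apply/eqP; rewrite eqEcard SF cS leqnn.
rewrite SE in det; rewrite -cover_lines; apply: (det _ _ xi L) => i il.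
  apply: (lifts_zero xi L l1F al1 ol1 ao) => //; apply: h; by rewrite !inE eqxx ?orbT.
apply: (lifts_zero xi L l2F bl2 ol2 bo) => //; apply: h; by rewrite !inE eqxx ?orbT.
Qed.

(** Let [v] be the last line in the growth. For [x] from a realisation, the kernel of the other
    lines consists of the combinations of 1, [x] and [z]. Moving a point [e] of [v] off [v], along
    the other line through [e], preserves this but breaks the condition on [v] for [z]; what remains
    are the combinations of 1 and [x], determined by two values. *)
Lemma kernel_le2 : (2 < #|F|)%N ->
  exists2 x : T -> K, injective x & exists2 B : {set T}, (#|B| <= 2)%N &
  forall z : T -> K, lifts F x z ->
    (forall b, b \in B -> z b = 0) -> forall i, i \in A -> z i = 0.
Proof.
move=> F3; have [l1 [l2 [o [l12 l1F l2F ol1 ol2]]]] := lines_meet.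
have [|S [SF l1S l2S cS det]] := @grow_lines _ _ l12 l1F l2F #|F|.-1.
  by rewrite leq_pred andbT; case: #|F| F3.
have c0 : (#|F|.-1 < #|F|)%N by case: #|F| F3.
have pS : S \proper F by rewrite properEcard SF cS.
have S2 : (1 < #|S|)%N by rewrite cS; case: #|F| F3.
have [v] := maximal_merge pS S2; rewrite in_setD => /andP [vS vF] v2.
have FS l : l \in F -> l = v \/ l \in S.
  have -> : F = v |: S.
    apply/esym/eqP; rewrite eqEcard subUset sub1set vF SF cardsU1 vS cS /=.
    by case: #|F| F3.
  by rewrite in_setU1 => /orP [/eqP|]; [left | right].
have v12 : uniq [:: l1; l2; v].
  rewrite /= !inE negb_or l12 andbT /=.
  by apply/andP; split; apply: contraNneq vS => <-.
have inS s p : s \in S -> p \in s -> p \in cover S.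
  by move=> sS ps; apply/bigcupP; exists s.
(* Otherwise some [p] lies on [v] alone, and every line of [S] meets [v] by [maximal_pendant]. They
   meet it in distinct points, since no point is on three lines, so there are only two of them. Then
   each of the three lines has a point on no other line, against [maximal_transversal]. *)
have v3 : (2 < #|v :&: cover S|)%N.
  rewrite ltnNge; apply/negP => v2'.
  have [p pv pS'] : exists2 p, p \in v & p \notin cover S.
    apply/subsetPn/negP => vU; have := line3 vF.
    by rewrite ltnNge -(setIidPl vU) v2'.
  have pu l : l \in F -> p \in l -> l = v.
    by move=> /FS [//|lS] pl; rewrite (inS _ _ lS pl) in pS'.
  pose f u := odflt p [pick q in u :&: v].
  have fP u : u \in S -> f u \in u :&: v.
    move=> uS; have /pred0Pn [q /andP [/= qu qv]] := maximal_pendant (subsetP SF _ uS) vF pv pu.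
    by rewrite /f; case: pickP => // /(_ q); rewrite in_setI qu qv.
  have S2' : (#|S| <= 2)%N.
    rewrite -(@card_in_imset _ _ f S).
      apply: leq_trans (subset_leq_card _) v2'; apply/subsetP => q /imsetP [u uS ->].
      have := fP u uS; rewrite !in_setI => /andP [fu ->]; exact: inS uS fu.
    move=> u u' uS uS' e; have := fP u uS; have := fP u' uS'; rewrite -e !in_setI.
    move=> /andP [q1 q2] /andP [q3 _]; apply/eqP; apply: contraT => uu.
    have /negP [] := no_three (subsetP SF _ uS) (subsetP SF _ uS') vF q3 q1 q2.
    rewrite /= !inE negb_or uu andbT /=.
    by apply/andP; split; apply: contraNneq vS => <-.
  have SE : S = [set l1; l2].
    apply/esym/eqP; rewrite eqEcard subUset !sub1set l1S l2S cards2 l12.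
    exact: S2'.
  have pendant m m' : m \in F -> m' \in F -> uniq [:: m; m'; v] -> S = [set m; m'] ->
      exists2 q, q \in m & forall l, l \in F -> q \in l -> l = m.
    move=> mF m'F; rewrite /= !inE negb_or => /and3P [/andP [mm mv] _ _] SE'.
    have [q [r [qr]]] := line_minus mF m'F mm.
    rewrite !in_setD => /andP [qm' qm] /andP [rm' rm].
    have main s : s \notin m' -> s \notin v -> forall l, l \in F -> s \in l -> l = m.
      move=> sm sv l /FS [->|]; first by rewrite (negPf sv).
      by rewrite SE' => /set2P [->|->] //; rewrite (negPf sm).
    have [qv|qv] := boolP (q \in v); last by exists q; last exact: main.
    exists r => //; apply: main => //; apply: contraNN mv => rv.
    by rewrite (lin qr mF vF qm rm qv rv).
  have [p1 p1l u1] := pendant _ _ l1F l2F v12 SE.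
  have v21 : uniq [:: l2; l1; v].
    apply: uniq3; first by rewrite eq_sym.
      by apply: contraNneq vS => <-.
    by apply: contraNneq vS => <-.
  have [|p2 p2l u2] := pendant _ _ l2F l1F v21; first by rewrite SE setUC.
  exact: maximal_transversal v12 l1F l2F vF p1l p2l pv u1 u2 pu.
case/card_gt2P: v3 => e [f [g [[]]]]; rewrite !in_setI => /andP [ev eU] /andP [fv fU].
move=> /andP [gv gU] [ef fg ge].
have /bigcupP [u uS eu] := eU; have uF := subsetP SF _ uS.
have [x [z0 [xi xz]]] := realise_lines Kinf lin two.
have [a1 [a2 [a12 a1u a2u]]] := line_points uF.
(* After an affine change of [z0], [u] is the line [z = 0]: moving [e] along [u]
   only changes the coordinate [x e]. *)
pose z y := cdet x z0 a1 a2 y.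
have zu y : y \in u -> z y = 0.
  move=> yu; have [un|nu] := boolP (uniq [:: a1; a2; y]); last exact: cdet_not_uniq.
  by apply/(xz _ _ _ un); exists u.
have xa : x a1 - x a2 != 0 by rewrite subr_eq0 (inj_eq xi).
have zE i j k : cdet x z i j k = (x a1 - x a2) * cdet x z0 i j k.
  by rewrite /z /cdet /det3; ring.
(* A value [c] not taken by [x] keeps the modified [x'] injective. *)
have [c cx] := Kinf [seq x y | y <- enum T].
have cx' y : c != x y by apply: contraNneq cx => ->; rewrite map_f // mem_enum.
pose x' y := if y == e then c else x y.
have x'e : x' e = c by rewrite /x' eqxx.
have x'n y : y != e -> x' y = x y by rewrite /x' => /negPf ->.
have x'i : injective x'.
  move=> y y'; rewrite /x'; case: eqP => [->|_]; case: eqP => [->|_] //.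
  - by move/eqP; rewrite (negPf (cx' _)).
  - by move/eqP; rewrite eq_sym (negPf (cx' _)).
  - exact: xi.
have vu : u != v by apply: contraNneq vS => <-.
have zv y : y \in v -> y != e -> z y != 0.
  move=> yv ye; have yu : y \notin u.
    by apply: contra vu => yu; apply/eqP; apply: lin ye uF vF yu eu yv ev.
  have un : uniq [:: a1; a2; y].
    rewrite /= !inE negb_or a12 andbT /=.
    by apply/andP; split; apply: contraNneq yu => <-.
  apply/eqP => /(xz _ _ _ un) [l lF [al bl yl]].
  by rewrite -(lin a12 lF uF al bl a1u a2u) yl in yu.
have ev_only l : l \in F -> e \in l -> l = u \/ l = v.
  move=> lF el; have := no_three lF uF vF el eu ev.
  rewrite /= !inE vu andbT negb_and orbF negbK => /orP [] /eqP; by [left | right].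
(* The only line of [S] through [e] is [u], where [z] vanishes; the other lines of [S] are not
   affected by the move. *)
have zL : lifts S x' z.
  move=> l i j k lS il jl kl; have [lu|lu] := eqVneq l u.
    by rewrite /cdet /det3 !zu -?lu // !mulr0 subrr addr0.
  have el : e \notin l.
    apply/negP => /(ev_only _ (subsetP SF _ lS)) [] le.
      by rewrite le eqxx in lu.
    by rewrite -le lS in vS.
  have ne y : y \in l -> y != e by move=> yl; apply: contraNneq el => <-.
  rewrite /cdet !x'n ?ne // -/(cdet x z i j k) zE.
  have [un|nu] := boolP (uniq [:: i; j; k]); last by rewrite cdet_not_uniq // mulr0.
  have -> : cdet x z0 i j k = 0 by apply/(xz _ _ _ un); exists l => //; exact: subsetP SF _ lS.
  by rewrite mulr0.
have fe : f != e by rewrite eq_sym.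
(* The move changes the determinant, which was zero, by [(c - x e) * (z g - z f)]. Equal values at
   [f] and [g] would extend along [v] to the zero at [e], although [z f] is nonzero. *)
have efg : cdet x' z e f g != 0.
  have un : uniq [:: e; f; g] by rewrite /= !inE negb_or ef fg eq_sym ge.
  have d0 : cdet x z e f g = 0.
    by rewrite zE (_ : cdet x z0 e f g = 0) ?mulr0 //; apply/(xz _ _ _ un); exists v.
  have ze := zu _ eu.
  have zfg : z g - z f != 0.
    rewrite subr_eq0; apply/eqP => zz; move/eqP: d0.
    rewrite /cdet /det3 ze zz.
    rewrite (_ : _ + _ = (x g - x f) * z f); last by ring.
    by rewrite mulf_eq0 subr_eq0 (inj_eq xi) eq_sym (negPf fg) (negPf (zv _ fv fe)).
  have -> : cdet x' z e f g = cdet x z e f g + (c - x e) * (z g - z f).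
    by rewrite /cdet /det3 x'e !x'n // ze; ring.
  by rewrite d0 add0r mulf_neq0 // subr_eq0.
(* The points [o], [a], [b] that control the growth are chosen away from [e], so that they keep
   their positions and stay noncollinear. *)
have oe : o != e.
  apply/eqP => oe; have ov : o \in v by rewrite oe.
  by have /negP [] := no_three l1F l2F vF ol1 ol2 ov.
have side m m' : m \in F -> m' \in F -> m != m' -> exists2 a, a \in m :\: m' & a != e.
  move=> mF mF' /(line_minus mF mF') [p [q [pq pm qm]]].
  have [pe|pe] := eqVneq p e; last by exists p.
  by exists q => //; rewrite -pe eq_sym.
have [a] := side _ _ l1F l2F l12; rewrite in_setD => /andP [al2 al1] ae.
have l21 : l2 != l1 by rewrite eq_sym.
have [b] := side _ _ l2F l1F l21; rewrite in_setD => /andP [bl1 bl2] be.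
have oa : o != a by apply: contraNneq al2 => <-.
have ob : o != b by apply: contraNneq bl1 => <-.
have ab : a != b by apply: contraNneq al2 => ->.
have oab : cdet x' z o a b != 0.
  have un : uniq [:: o; a; b] by rewrite /= !inE negb_or oa ob ab.
  rewrite /cdet !x'n // -/(cdet x z o a b) zE mulf_neq0 //.
  apply/eqP => /(xz _ _ _ un) [l lF [ol al bl]].
  by rewrite -(lin oa lF l1F ol al ol1 al1) bl in bl1.
have xoa : x' o != x' a by rewrite (inj_eq x'i).
exists x' => //; exists [set f; g]; first by rewrite cards2; case: (_ != _).
move=> w Lw w0.
have [k [d1 [d0 wE]]] := interpolate w xoa oab.
(* The difference between [w] and its interpolant is in the kernel for [S] and vanishes at [o], [a],
   [b], hence on all of [cover S]. *)
pose w' y := w y - (k * z y + d1 * x' y + d0).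
have w'L : lifts S x' w'.
  move=> l i j m lS il jl ml.
  have -> : cdet x' w' i j m = cdet x' w i j m - k * cdet x' z i j m.
    by rewrite /w' /cdet /det3; ring.
  rewrite (zL l) // mulr0 subr0; apply: (Lw l) => //; exact: subsetP SF _ lS.
have w'0 q : q \in [:: o; a; b] -> w' q = 0 by move=> /wE; rewrite /w' => ->; rewrite subrr.
have w'S : forall i, i \in cover S -> w' i = 0.
  apply: (det _ _ x'i w'L) => i il.
    by apply: (lifts_zero x'i w'L l1S ol1 al1 oa) => //; apply: w'0; rewrite !inE eqxx ?orbT.
  by apply: (lifts_zero x'i w'L l2S ol2 bl2 ob) => //; apply: w'0; rewrite !inE eqxx ?orbT.
have wS i : i \in cover S -> w i = k * z i + d1 * x' i + d0.
  by move=> /w'S /eqP; rewrite subr_eq0 => /eqP.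
(* Here the condition on the line [v] is used, through [e], [f], [g]; the zeros at [f] and [g] then
   remove [d1] and [d0]. *)
have k0 : k = 0.
  have /eqP := Lw v e f g vF ev fv gv.
  have -> : cdet x' w e f g = k * cdet x' z e f g.
    by rewrite -(cdet_affine x' z k d1 d0) /cdet !wS.
  by rewrite mulf_eq0 (negPf efg) orbF => /eqP.
have wf : w f = 0 by apply: w0; rewrite set21.
have wg : w g = 0 by apply: w0; rewrite set22.
have d10 : d1 = 0.
  have /eqP : d1 * (x' f - x' g) = w f - w g by rewrite !wS // k0; ring.
  by rewrite wf wg subrr mulf_eq0 subr_eq0 (inj_eq x'i) (negPf fg) orbF => /eqP.
have d00 : d0 = 0 by have := wS _ fU; rewrite wf k0 d10 !mul0r !add0r.
move=> i; rewrite -cover_lines => /bigcupP [l /FS [->|lS] il].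
  exact: (lifts_zero x'i Lw vF fv gv fg wf wg).
by rewrite wS ?k0 ?d10 ?d00 ?mul0r ?add0r //; apply: inS lS il.
Qed.

End MaximalStructure.

(** * The collinearity matrix *)

Section Kernel.
Variables (K : fieldType) (n : nat).

(** Rank-nullity: [kermx] is a kernel acting on rows, so the solutions are parametrised by the
    transpose of a row base of the kernel of [A^T]. *)
Lemma dim_solution_space m (A : 'M[K]_(m, n)) :
  (\dim (solution_space A) + \rank A)%N = n.
Proof.
pose B := (row_base (kermx A^T))^T.
have inj : lker (linfun (mulmx B : 'cV[K]_(\rank (kermx A^T)) -> 'cV[K]_n)) = 0%VS.
  apply/eqP; rewrite -subv0; apply/subvP => v; rewrite memv_ker lfunE /= memv0 => /eqP h.
  rewrite -(trmxK v) -(inj_eq trmx_inj) trmxK trmx0.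
  apply/eqP/(row_free_inj (row_base_free (kermx A^T))).
  by rewrite mul0mx; apply: trmx_inj; rewrite trmx_mul trmxK h trmx0.
have -> : solution_space A = limg (linfun (mulmx B : 'cV[K]__ -> 'cV[K]_n)).
  apply/vspaceP => v; rewrite memv_ker lfunE /=; apply/idP/memv_imgP.
    move=> /eqP Av; have : (v^T <= row_base (kermx A^T))%MS.
      by rewrite eq_row_base; apply/sub_kermxP; rewrite -trmx_mul Av trmx0.
    case/submxP => D hD; exists D^T; first exact: memvf.
    by rewrite lfunE /=; apply: trmx_inj; rewrite trmx_mul !trmxK.
  case=> w _ ->; rewrite lfunE /= mulmxA.
  have : (row_base (kermx A^T) <= kermx A^T)%MS by rewrite eq_row_base.
  by move/sub_kermxP => h; apply/eqP/trmx_inj; rewrite trmx_mul trmx_mul trmxK h mulmx0 trmx0.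
rewrite limg_dim_eq ?inj ?capv0 //. rewrite dimvf dim_matrix mulr1 mxrank_ker mxrank_tr subnK //.
exact: rank_leq_col.
Qed.

Let ev (B : {set 'I_n}) : 'Hom('cV[K]_n, 'cV[K]_#|B|) :=
  linfun (mulmx (rowsub (fun i : 'I_#|B| => enum_val i) 1%:M)).

Let evE B w i : ev B w i 0 = w (enum_val i) 0.
Proof. by rewrite lfunE /= mul_rowsub_mx mul1mx mxE. Qed.

(** Restriction to the coordinates in [B] is injective on [W]. *)
Lemma dim_le_card (W : {vspace 'cV[K]_n}) (B : {set 'I_n}) :
  (forall w, w \in W -> (forall b, b \in B -> w b 0 = 0) -> w = 0) ->
  (\dim W <= #|B|)%N.
Proof.
move=> h; rewrite -(@limg_dim_eq _ _ _ (ev B)).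
  by apply: leq_trans (dimvS (subvf _)) _; rewrite dimvf dim_matrix mulr1.
apply/eqP; rewrite -subv0; apply/subvP => w; rewrite memv_cap memv_ker memv0.
case/andP => wW /eqP we; apply/eqP/h => // b bB.
by rewrite -(enum_rankK_in bB bB) -evE we mxE.
Qed.

(** Restriction to the coordinates in [B] maps [W] onto the whole space, because multiples of all
    unit vectors are reached. *)
Lemma dim_ge_card (W : {vspace 'cV[K]_n}) (B : {set 'I_n}) :
  (forall b, b \in B -> exists2 w, w \in W &
     w b 0 != 0 /\ forall b', b' \in B -> b' != b -> w b' 0 = 0) ->
  (#|B| <= \dim W)%N.
Proof.
move=> h; rewrite -(limg_ker_dim (ev B) W).
suff -> : (ev B @: W)%VS = fullv by rewrite dimvf dim_matrix mulr1 leq_addl.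
apply/eqP; rewrite eqEsubv subvf; apply/subvP => v _.
have -> : v = \sum_i v i 0 *: delta_mx i 0.
  by rewrite [LHS]matrix_sum_delta; apply: eq_bigr => i _; rewrite big_ord1.
apply: memv_suml => i _; apply: memvZ.
have [w wW [wb wb']] := h _ (enum_valP i).
have -> : delta_mx i 0 = (w (enum_val i) 0)^-1 *: ev B w.
  apply/colP => j; rewrite [LHS]mxE [RHS]mxE evE eqxx andbT.
  have [->|ji] := eqVneq j i; first by rewrite mulVf.
  have -> : w (enum_val j) 0 = 0.
    by apply: wb'; [exact: enum_valP | rewrite (inj_eq enum_val_inj)].
  by rewrite mulr0.
by rewrite memvZ // memv_img.
Qed.

End Kernel.

Lemma infinite_numField (K : numFieldType) : infinite_field K.
Proof.
move=> s; pose t := [seq k%:R : K | k <- iota 0 (size s).+1].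
have ut : uniq t.
  rewrite map_inj_uniq ?iota_uniq // => a b /eqP; by rewrite eqr_nat => /eqP.
have [/allP h|/allPn [k _ ks]] := boolP (all (mem s) t); last by exists k.
by have := uniq_leq_size ut h; rewrite size_map size_iota ltnn.
Qed.

Section CollinearityKernel.
Variables (K : fieldType) (n : nat) (C : config 'I_n).

(** The rows only list increasing triples. Since [cdet] is alternating, its vanishing passes to
    every order, and it is automatic when entries repeat. *)
Lemma solution_spaceP (x : 'I_n -> K) (z : 'cV[K]_n) :
  z \in solution_space (collinearity_matrix C x) <-> lifts (lines C) x (fun i => z i 0).
Proof.
have row r : (collinearity_matrix C x *m z) r 0 =
    let: (i, j, k) := enum_val r in cdet x (fun i => z i 0) i j k.
  rewrite mxE; under eq_bigr do rewrite mxE.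
  have := enum_valP r; case: (enum_val r) => [[i j] k]; rewrite inE /= => /andP [/andP [ij jk] _].
  have ji : j != i by rewrite neq_ltn ij orbT.
  have ki : k != i by rewrite neq_ltn (ltn_trans ij jk) orbT.
  have kj : k != j by rewrite neq_ltn jk orbT.
  rewrite (bigD1 i) //= (bigD1 j) //= (bigD1 k) /=; last by rewrite ki.
  rewrite big1 => [|c /andP [/andP [/negPf -> /negPf ->] /negPf ->]]; last by rewrite mul0r.
  by rewrite !eqxx (negPf ji) (negPf ki) (negPf kj) /cdet /det3; ring.
rewrite memv_ker lfunE /=; split=> [/eqP h l i j k lC il jl kl|h].
  have sorted (a b c : 'I_n) : (a < b < c)%N -> a \in l -> b \in l -> c \in l ->
      cdet x (fun i => z i 0) a b c = 0.
    move=> abc al bl cl; have tT : (a, b, c) \in collinear_triples C.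
      by rewrite inE /= abc; apply/existsP; exists l; rewrite lC al bl cl.
    by have := row (enum_rank_in tT (a, b, c)); rewrite h mxE enum_rankK_in.
  have [u|u] := boolP (uniq [:: i; j; k]); last exact: cdet_not_uniq.
  move: u; rewrite /= !inE negb_or andbT => /andP [/andP [ij ik] jk].
  have cC a b c : cdet x (fun i => z i 0) a b c = 0 -> cdet x (fun i => z i 0) b a c = 0.
    by move=> e; rewrite cdetC e oppr0.
  case: (ltngtP i j) => [lij|lij|/val_inj e]; last by rewrite e eqxx in ij.
    case: (ltngtP j k) => [ljk|lkj|/val_inj e]; last by rewrite e eqxx in jk.
      by apply: sorted; rewrite // lij.
    case: (ltngtP i k) => [lik|lki|/val_inj e]; last by rewrite e eqxx in ik.
      by rewrite -cdetR; apply: (cC _ _ _); rewrite cdetR; apply: sorted; rewrite // lik.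
    by rewrite -cdetR -cdetR; apply: sorted; rewrite // lki.
  apply: (cC _ _ _); case: (ltngtP i k) => [lik|lki|/val_inj e]; last by rewrite e eqxx in ik.
    by apply: sorted; rewrite // lij.
  case: (ltngtP j k) => [ljk|lkj|/val_inj e]; last by rewrite e eqxx in jk.
    by rewrite -cdetR; apply: (cC _ _ _); rewrite cdetR; apply: sorted; rewrite // ljk.
  by rewrite -cdetR -cdetR; apply: sorted; rewrite // lkj.
apply/eqP/colP => r; rewrite row mxE; have := enum_valP r.
case: (enum_val r) => [[i j] k]; rewrite inE /= => /andP [_ /exists_inP [l lC /and3P [? ? ?]]].
exact: h lC _ _ _.
Qed.

End CollinearityKernel.

(** * Components *)

Section Components.
Variables (n : nat) (C : config 'I_n).

Lemma config_graph_sym : symmetric (config_graph C).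
Proof.
by move=> i j; apply/exists_inP/exists_inP => -[l lC h]; exists l; rewrite // orbC.
Qed.

(** Induction on the distance: two points of a line are either consecutive on it or separated by a
    third point of it. *)
Lemma line_connect l i j : l \in lines C -> i \in l -> j \in l -> (i < j)%N ->
  connect (config_graph C) i j.
Proof.
move=> lC; have [m] := ubnP (j - i)%N; elim: m i j => // m IH i j h il jl ij.
have [c|] := boolP (consecutive l i j).
  by apply/connect1/exists_inP; exists l; rewrite // c.
rewrite /consecutive il jl ij /= => /forall_inPn [k kl]; rewrite negbK => /andP [ik kj].
by apply: (connect_trans (y := k)); apply: IH => //; move: h; lia.
Qed.

Lemma line_connect2 l i j : l \in lines C -> i \in l -> j \in l ->
  connect (config_graph C) i j.
Proof.
move=> lC il jl; case: (ltngtP i j) => [ij|ji|/val_inj -> //].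
  exact: line_connect lC il jl ij.
rewrite (sym_connect_sym config_graph_sym); exact: line_connect lC jl il ji.
Qed.

Let comp_equiv : {in points C & &, equivalence_rel (connect (config_graph C))}.
Proof.
move=> i j k _ _ _; split=> // ij; apply/idP/idP; last exact: connect_trans.
by apply: connect_trans; rewrite (sym_connect_sym config_graph_sym).
Qed.

Lemma component_partition : partition (component_sets C) (points C).
Proof. exact: equivalence_partitionP comp_equiv. Qed.

Hypothesis C_points : points C = [set: 'I_n].

Lemma in_component i : exists2 B, B \in component_sets C & i \in B.
Proof.
have := cover_partition component_partition; rewrite C_points => h.
have : i \in cover (component_sets C) by rewrite h inE.
by case/bigcupP => B; exists B.
Qed.

Lemma component_eq B B' i : B \in component_sets C -> B' \in component_sets C ->
  i \in B -> i \in B' -> B = B'.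
Proof.
move=> BC BC' iB iB'; have /and3P [_ tr _] := component_partition.
by rewrite -(def_pblock tr BC iB) (def_pblock tr BC' iB').
Qed.

Lemma component_connect B i j : B \in component_sets C -> i \in B ->
  (j \in B) = connect (config_graph C) i j.
Proof.
move=> BC iB; have /and3P [_ tr _] := component_partition.
rewrite -(def_pblock tr BC iB).
by rewrite (pblock_equivalence_partition comp_equiv) // C_points inE.
Qed.

Lemma line_component B l i : B \in component_sets C -> l \in lines C ->
  i \in l -> i \in B -> l \subset B.
Proof.
move=> BC lC il iB; apply/subsetP => j jl.
by rewrite (component_connect _ BC iB) (line_connect2 lC).
Qed.

Lemma lines_in_or_out B l : B \in component_sets C -> l \in lines C ->
  l \subset B \/ forall i, i \in l -> i \notin B.
Proof.
move=> BC lC; have [/exists_inP [i il iB]|/exists_inPn no] := boolP [exists i in l, i \in B].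
  by left; apply: line_component iB.
by right.
Qed.

(** Rank three gives a component more than one point, and the first edge of a path leaving [i] lies
    on a line through [i]. *)
Lemma component_cover B (M : matroid 'I_n) : B \in component_sets C ->
  mrank M (ground M) = 3%N -> subconfig C B = matroid_config M ->
  [/\ ground M = B, lines (matroid_config M) = [set l in lines C | l \subset B] &
      cover [set l in lines C | l \subset B] = ground M].
Proof.
move=> BC rM e; have gB : ground M = B by rewrite -[LHS]/(points (matroid_config M)) -e.
split=> //; first by rewrite -e.
rewrite gB; apply/eqP; rewrite eqEsubset; apply/andP; split.
  by apply/bigcupsP => l; rewrite inE => /andP [].
apply/subsetP => i iB.
have [I [Ii IB cI]] : exists I, [/\ I \in indep M, I \subset B & (2 < #|I|)%N].
  by apply: lt_mrank; rewrite -gB rM.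
have /card_gt0P [j] : (0 < #|B :\ i|)%N.
  by have := leq_trans cI (subset_leq_card IB); rewrite (cardsD1 i) iB => /ltnW.
rewrite in_setD1 => /andP [ji]; rewrite (component_connect _ BC iB) => /connectP [[|k p] /=].
  by move=> _ e'; rewrite e' eqxx in ji.
case/andP => /exists_inP [l lC h] _ _.
have il : i \in l by case/orP: h => /and4P [].
by apply/bigcupP; exists l; rewrite // inE lC; apply: line_component il iB.
Qed.

End Components.

(** * The kernel as a sum over the components *)

Section Forward.
Variables (K : fieldType) (n : nat) (C : config 'I_n).
Hypothesis Kinf : infinite_field K.
Hypothesis C_points : points C = [set: 'I_n].
Hypothesis C_linear : linear_config C.
Hypothesis C_components : forall A, A \in component_sets C ->
   exists M : matroid 'I_n, maximal_matroid K M /\ subconfig C A = matroid_config M.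

Let FA (A : {set 'I_n}) := [set l in lines C | l \subset A].

Let lin : linear_family (lines C).
Proof. by case: C_linear. Qed.

Let compM A : A \in component_sets C -> exists M : matroid 'I_n,
  [/\ maximal_matroid K M, ground M = A, lines (matroid_config M) = FA A & cover (FA A) = ground M].
Proof.
move=> AC; have [M [Mmax e]] := C_components AC; exists M.
by have [] := component_cover C_points AC _ e; first by case: Mmax => [[]].
Qed.

Let lifts_FA A (x z : 'I_n -> K) : lifts (lines C) x z -> lifts (FA A) x z.
Proof. by move=> L l i j k; rewrite inE => /andP [lC _]; apply: L. Qed.

Lemma component_noncollinear A : A \in component_sets C ->
  exists i j k, [/\ uniq [:: i; j; k], [set i; j; k] \subset A & ~~ collinear (lines C) i j k].
Proof.
move=> AC; have [M [[[Msimple rM _ _] _] gM LM _]] := compM AC.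
have [I [Ii IA cI]] : exists I, [/\ I \in indep M, I \subset A & (2 < #|I|)%N].
  by apply: lt_mrank; rewrite -gM rM.
have [i [j [k [[iI jI kI] [ij jk ki]]]]] := card_gt2P cI.
have u : uniq [:: i; j; k] by apply: uniq3; rewrite // eq_sym.
have sI : [set i; j; k] \subset I by rewrite !subUset !sub1set iI jI kI.
have sA := subset_trans sI IA.
exists i, j, k; split=> //; apply/negP => /collinearP [l lC [il jl kl]].
have iA : i \in A by apply: (subsetP IA).
have lM : l \in lines (matroid_config M).
  by rewrite LM inE lC (line_component C_points AC lC il iA).
have := line_indep Msimple lM il jl _ u; rewrite kl (indepS sI Ii) gM.
by rewrite (subsetP IA _ kI) => /(_ isT).
Qed.

Let setdim (P : {set {set 'I_n}}) (B : {set 'I_n} -> {set 'I_n}) :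
  (#|\bigcup_(A in P) B A| <= \sum_(A in P) #|B A|)%N.
Proof.
elim/big_rec2: _ => [|A m U _ h]; first by rewrite cards0.
by apply: leq_trans (leq_card_setU _ _) _; rewrite leq_add2l.
Qed.

(** If a component [A0] had more than two lines, the [x] from [kernel_le2] would let it contribute
    at most 2. For this same [x] the others contribute at most 3 each by [kernel_le3], and the total
    would be below [3 * omega C]. *)
Lemma components_two_lines :
  (forall x : 'I_n -> K, injective x ->
     (3 * omega C <= \dim (solution_space (collinearity_matrix C x)))%N) ->
  forall A, A \in component_sets C -> exists l1 l2 o,
    [/\ FA A = [set l1; l2], l1 != l2, o \in l1 & o \in l2].
Proof.
move=> dim_ge A0 A0C; have [M0 [M0max gM0 LM0 cM0]] := compM A0C.
have [l1 [l2 [o [l12 l1F l2F ol1 ol2]]]] := lines_meet Kinf M0max LM0 cM0.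
suff F2 : (#|FA A0| <= 2)%N.
  exists l1, l2, o; split=> //; apply/esym/eqP.
  by rewrite eqEcard subUset !sub1set l1F l2F cards2 l12.
rewrite leqNgt; apply/negP => F3.
have [x xi [B0 B0c B0z]] := kernel_le2 Kinf M0max LM0 cM0 F3.
(* The summand [A == A0], read as 0 or 1, records the deficit of the component [A0]. *)
have /fin_all_exists [B hB] : forall A : {set 'I_n}, exists BA : {set 'I_n},
    A \in component_sets C ->
    (#|BA| + (A == A0) <= 3)%N /\ forall z : 'I_n -> K, lifts (lines C) x z ->
    (forall b, b \in BA -> z b = 0) -> forall i, i \in A -> z i = 0.
    move=> A; have [AC|nAC] := boolP (A \in component_sets C); last by exists set0.
    have [->|nA] := eqVneq A A0.
      exists B0 => _; split; first by rewrite addn1.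
      by move=> z /(lifts_FA (A := A0)) Lz h i iA; apply: (B0z z Lz h); rewrite gM0.
    have [M [Mmax gM LM cM]] := compM AC.
    have [BA BAc BAz] := kernel_le3 Kinf Mmax LM cM.
    exists BA => _; split; first by rewrite addn0.
    by move=> z /(lifts_FA (A := A)) Lz h i iA; apply: (BAz x z xi Lz h); rewrite gM.
have := dim_ge x xi; rewrite leqNgt => /negP; apply.
apply: leq_ltn_trans (_ : #|\bigcup_(A in component_sets C) B A| < _)%N.
  apply: dim_le_card => w /(solution_spaceP _ _ _) Lw w0.
  apply/colP => i; rewrite mxE; have [A AC iA] := in_component C_points i.
  have [_ /(_ _ Lw)] := hB A AC; apply=> // b bB; apply: w0.
  by apply/bigcupP; exists A.
apply: leq_ltn_trans (setdim _ _) _; rewrite /omega mulnC -sum_nat_const.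
rewrite (bigD1 A0) //= [X in (_ < X)%N](bigD1 A0) //= -addSn; apply: leq_add.
  by have [] := hB A0 A0C; rewrite eqxx addn1.
apply: leq_sum => A /andP [AC nA]; have [h _] := hB A AC.
by apply: leq_trans h; rewrite leq_addr.
Qed.

(** For a noncollinear triple [p], [q], [r], the function [cdet x z y q r] of [y] is a combination
    of 1, [x] and [z] that vanishes at [q] and [r] but not at [p]. Extending it by zero outside [A]
    stays in the kernel, because each line is inside [A] or disjoint from it. *)
Lemma component_dual (x z : 'I_n -> K) A :
  A \in component_sets C -> lifts (lines C) x z ->
  (forall i j k, uniq [:: i; j; k] -> ~~ collinear (lines C) i j k -> cdet x z i j k != 0) ->
  exists B : {set 'I_n}, [/\ B \subset A, #|B| = 3%N & forall b, b \in B ->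
    exists w : 'I_n -> K, [/\ lifts (lines C) x w, w b != 0,
      forall b', b' \in B -> b' != b -> w b' = 0 & forall i, i \notin A -> w i = 0]].
Proof.
move=> AC Lz nz; have [i [j [k [u sA nc]]]] := component_noncollinear AC.
exists [set i; j; k]; split; [by []|exact: card_set3|].
have main p q r : cdet x z p q r != 0 -> [set p; q; r] = [set i; j; k] ->
    exists w : 'I_n -> K, [/\ lifts (lines C) x w, w p != 0,
      forall b', b' \in [set i; j; k] -> b' != p -> w b' = 0 & forall i, i \notin A -> w i = 0].
  move=> pqr e; pose w y := if y \in A then cdet x z y q r else 0.
  have pA : p \in A by apply: (subsetP sA); rewrite -e !inE eqxx.
  exists w; split.
  - move=> l a b c lC al bl cl; have [lA|lA] := lines_in_or_out C_points AC lC.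
      have -> : cdet x w a b c = (x q - x r) * cdet x z a b c.
        by rewrite /cdet /w !(subsetP lA) // /cdet /det3; ring.
      by rewrite (Lz l) // mulr0.
    by rewrite /cdet /det3 /w !(negPf (lA _ _)) // !mulr0 subrr addr0.
  - by rewrite /w pA.
  - move=> b; rewrite -e !inE -orbA /w => /or3P [] /eqP ->; rewrite ?eqxx // => _;
      case: ifP => // _.
      by rewrite /cdet /det3; ring.
    by rewrite /cdet /det3; ring.
  - by move=> y /negPf yA; rewrite /w yA.
have D := nz _ _ _ u nc.
move=> b; rewrite !inE -orbA => /or3P [] /eqP ->.
- exact: (main i j k).
- apply: (main j k i); first by rewrite cdetR.
  by apply/setP => y; rewrite !inE; do 3!case: eqP.
- apply: (main k i j); first by rewrite -cdetR.
  by apply/setP => y; rewrite !inE; do 3!case: eqP.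
Qed.

Lemma dim_of_lift (x z : 'I_n -> K) :
  lifts (lines C) x z ->
  (forall i j k, uniq [:: i; j; k] -> ~~ collinear (lines C) i j k -> cdet x z i j k != 0) ->
  (3 * omega C <= \dim (solution_space (collinearity_matrix C x)))%N.
Proof.
move=> Lz nz.
(* The value [set0] outside the components makes the sets [B A] disjoint over all [A]. *)
have /fin_all_exists [B hB] : forall A : {set 'I_n}, exists B : {set 'I_n},
    if A \in component_sets C then
    [/\ B \subset A, #|B| = 3%N & forall b, b \in B ->
    exists w : 'I_n -> K, [/\ lifts (lines C) x w, w b != 0,
      forall b', b' \in B -> b' != b -> w b' = 0 & forall i, i \notin A -> w i = 0]]
    else B = set0.
  move=> A; have [AC|_] := boolP (A \in component_sets C); last by exists set0.
  exact: (component_dual AC Lz nz).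
have dB A A' : A != A' -> [disjoint B A & B A'].
  move=> AA; have := hB A; have := hB A'; case: ifP => [A'C|_];
    last by move=> -> _; rewrite -setI_eq0 setI0.
  move=> [BA' _ _]; case: ifP => [AC|_]; last by move=> ->; rewrite -setI_eq0 set0I.
  move=> [BA _ _]; apply/pred0P => i /=; apply/andP => -[iB iB']; move/negP: AA; apply; apply/eqP.
  exact: (component_eq AC A'C (subsetP BA _ iB) (subsetP BA' _ iB')).
apply: leq_trans (_ : #|\bigcup_A B A| <= _)%N.
  rewrite -sum1_card (partition_disjoint_bigcup _ _ dB) /=.
  rewrite /omega mulnC -sum_nat_const [X in (_ <= X)%N](bigID (mem (component_sets C))) /=.
  apply: leq_trans (leq_addr _ _); apply: leq_sum => A AC.
  by rewrite sum1_card; have := hB A; rewrite AC => -[_ -> _].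
apply: dim_ge_card => b /bigcupP [A _ bB]; have := hB A; case: ifP => [AC|_ BE]; last first.
  by rewrite BE inE in bB.
move=> [BA _ /(_ b bB) [w [Lw wb wb' wA]]].
have wE : (fun i => (\col_i w i) i 0) =1 w by move=> i; rewrite mxE.
exists (\col_i w i).
  apply/(solution_spaceP _ _ _) => l i j k lC il jl kl.
  by rewrite /cdet !wE; apply: Lw lC il jl kl.
rewrite wE; split=> // b' /bigcupP [A' _ b'B] bb'; rewrite wE.
have [b'A|] := boolP (b' \in A); last exact: wA.
apply: wb' bb'; have := hB A'; case: ifP => [A'C|_ BE]; last by rewrite BE inE in b'B.
by move=> [BA' _ _]; rewrite (component_eq AC A'C b'A (subsetP BA' _ b'B)).
Qed.

(** The lifts of [x] form a linear space, so by [common_nonzero] it is enough to find, for each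
    noncollinear triple, one lift that separates it. *)
Lemma generic_lift (x : 'I_n -> K) : injective x ->
  (forall A, A \in component_sets C -> exists l1 l2 o,
    [/\ FA A = [set l1; l2], l1 != l2, o \in l1 & o \in l2]) ->
  exists z : 'I_n -> K, lifts (lines C) x z /\
  (forall i j k, uniq [:: i; j; k] -> ~~ collinear (lines C) i j k -> cdet x z i j k != 0).
Proof.
move=> xi two.
pose good i j k := exists2 z : 'I_n -> K, lifts (lines C) x z & cdet x z i j k != 0.
have goodR i j k : good i j k -> good j k i by case=> z L h; exists z => //; rewrite cdetR.
have alone i j k A : A \in component_sets C -> i \in A -> j \notin A -> k \notin A ->
    j != k -> good i j k.
  move=> AC iA jA kA jk; exists (fun y => (y \in A)%:R).
    move=> l a b c lC al bl cl; have [lA|lA] := lines_in_or_out C_points AC lC.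
      by rewrite /cdet !(subsetP lA) // /det3; ring.
    by rewrite /cdet !(negPf (lA _ _)) // /det3 !mulr0 subrr addr0.
  rewrite /cdet /det3 iA (negPf jA) (negPf kA) !mulr0 subr0 addr0 mulr1.
  by rewrite subr_eq0 (inj_eq xi).
have same i j k A m m' o : A \in component_sets C -> FA A = [set m; m'] -> m != m' ->
    o \in m -> o \in m' -> i \in m -> j \in m -> k \in m' -> k \notin m -> i != j -> good i j k.
  move=> AC FE mm om om' im jm km' km ij.
  have /andP [mC mA] : (m \in lines C) && (m \subset A).
    by have := set21 m m'; rewrite -FE inE.
  have /andP [mC' mA'] : (m' \in lines C) && (m' \subset A).
    by have := set22 m m'; rewrite -FE inE.
  have meet y : y \in m -> y \in m' -> y = o.
    move=> ym ym'; apply/eqP; apply: contraT => yo; move: mm.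
    by rewrite (lin yo mC mC' ym om ym' om') eqxx.
  pose z y := if y \in m' then x y - x o else 0.
  have zm y : y \in m -> z y = 0.
    by move=> ym; rewrite /z; case: ifP => // ym'; rewrite (meet y) // subrr.
  exists z.
    move=> l a b c lC al bl cl; have [lm|lm] := eqVneq l m'.
      by rewrite /cdet /z -lm al bl cl /det3; ring.
    have zl y : y \in l -> z y = 0.
      move=> yl; have [ym'|ym'] := boolP (y \in m'); last by rewrite /z (negPf ym').
      apply: zm; have : l \in FA A.
        by rewrite inE lC (line_component C_points AC lC yl) // (subsetP mA').
      by rewrite FE => /set2P [<-//|lm']; rewrite lm' eqxx in lm.
    by rewrite /cdet /det3 !zl // !mulr0 subrr addr0.
  rewrite /cdet /det3 (zm i) // (zm j) // !mulr0 subrr add0r /z km' mulf_neq0 //.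
    by rewrite subr_eq0 (inj_eq xi).
  by rewrite subr_eq0 (inj_eq xi); apply: contraNneq km => ->.
have exgood i j k : uniq [:: i; j; k] -> ~~ collinear (lines C) i j k -> good i j k.
  move=> u nc; have /and3P [] := u; rewrite !inE negb_or => /andP [ij ik] jk _.
  have [ji ki kj] : [/\ j != i, k != i & k != j] by rewrite ![_ == i]eq_sym [k == j]eq_sym.
  have [A AC iA] := in_component C_points i.
  have [jA|jA] := boolP (j \in A); have [kA|kA] := boolP (k \in A).
  - have [m [m' [o [FE mm om om']]]] := two A AC.
    have cov y : y \in A -> (y \in m) || (y \in m').
      have [M [_ gM _ cM]] := compM AC; rewrite -gM -cM FE => /bigcupP [l].
      by rewrite !inE => /orP [] /eqP -> ->; rewrite ?orbT.
    have nin l : l \in FA A -> ~~ [&& i \in l, j \in l & k \in l].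
      rewrite inE => /andP [lC _]; apply: contra nc => h; by apply/exists_inP; exists l.
    have FE' : FA A = [set m'; m] by rewrite FE setUC.
    have mm' : m' != m by rewrite eq_sym.
    have s1 a b c := @same a b c A m m' o AC FE mm om om'.
    have s2 a b c := @same a b c A m' m o AC FE' mm' om' om.
    have := nin m; rewrite FE set21 => /(_ isT); have := nin m'; rewrite FE set22 => /(_ isT).
    have := cov i iA; have := cov j jA; have := cov k kA.
    have [im|im] := boolP (i \in m); have [jm|jm] := boolP (j \in m);
      have [km|km] := boolP (k \in m) => //=.
    + by move=> km' _ _ _ _; apply: s1.
    + by move=> _ jm' _ _ _; apply: (goodR _ _ _); apply: s1.
    + move=> km' jm' _; rewrite km' jm' !andbT => im' _.
      by apply: (goodR _ _ _); apply: (goodR _ _ _); apply: s2.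
    + by move=> _ _ im' _ _; apply: (goodR _ _ _); apply: (goodR _ _ _); apply: s1.
    + move=> km' _ im'; rewrite km' im' andbT /= => jm' _.
      by apply: (goodR _ _ _); apply: s2.
    + move=> _ jm' im'; rewrite im' jm' /= => km' _.
      by apply: s2.
    + by move=> -> -> ->.
  - have [A' A'C kA'] := in_component C_points k.
    have out y : y \in A -> y \notin A'.
      by move=> yA; apply: contra kA => yA'; rewrite (component_eq AC A'C yA yA').
    by apply: (goodR _ _ _); apply: (alone k i j A') => //; apply: out.
  - have [A' A'C jA'] := in_component C_points j.
    have out y : y \in A -> y \notin A'.
      by move=> yA; apply: contra jA => yA'; rewrite (component_eq AC A'C yA yA').
    by apply: (goodR _ _ _); apply: (goodR _ _ _); apply: (alone j k i A') => //; apply: out.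
  - exact: alone iA jA kA jk.
pose J := ('I_n * 'I_n * 'I_n)%type.
pose f (t : J) (z : 'I_n -> K) := cdet x z t.1.1 t.1.2 t.2.
pose ok (t : J) := uniq [:: t.1.1; t.1.2; t.2] && ~~ collinear (lines C) t.1.1 t.1.2 t.2.
have [|||||z Lz hz] := @common_nonzero K Kinf 'I_n J (lifts (lines C) x) f (enum ok) (fun=> 0).
- by move=> l i j k _ _ _ _; rewrite /cdet /det3 !mulr0 subrr addr0.
- move=> t t' s L L' l i j k lC il jl kl.
  have -> : cdet x (fun v => t v + s * (t' v - t v)) i j k =
    cdet x t i j k + s * (cdet x t' i j k - cdet x t i j k) by rewrite /cdet /det3; ring.
  by rewrite (L l) // (L' l) // subrr mulr0 addr0.
- by move=> j t t' tt'; rewrite /f /cdet !tt'.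
- move=> j _; rewrite /f /cdet /det3.
  by repeat first [ apply: poly_on_lines_add | apply: poly_on_lines_opp
                  | apply: poly_on_lines_mul | apply: poly_on_lines_coord
                  | apply: poly_on_lines_const ].
- by move=> [[i j] k]; rewrite mem_enum unfold_in /= => /andP [u nc]; exact: exgood.
exists z; split=> // i j k u nc.
by apply: (hz (i, j, k)); rewrite mem_enum; apply/andP.
Qed.

End Forward.

(** * Liftings in the projective plane *)

Section Plane.
Variable K : fieldType.
Implicit Types (e : 3.-tuple 'cV[K]_3) (l : pline K) (P Q V : ppoint K).

Lemma ppointP P : exists2 p, p != 0 & val P = <[p]>%VS.
Proof.
have /eqP d := valP P; exists (vpick (val P)).
  by rewrite vpick0 -dimv_eq0 d.
have p0 : vpick (val P) != 0 by rewrite vpick0 -dimv_eq0 d.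
by apply/esym/eqP; rewrite eqEdim dim_vline p0 d leqnn -memvE memv_pick.
Qed.

Lemma ppoint_line (p : 'cV[K]_3) : p != 0 -> exists P, val P = <[p]>%VS.
Proof.
move=> p0; have d : \dim <[p]>%VS == 1%N by rewrite dim_vline p0.
by exists (exist (fun U : {vspace 'cV[K]_3} => \dim U == 1%N) _ d).
Qed.

Lemma pline_span (p q : 'cV[K]_3) : free [:: p; q] -> exists l, val l = <<[:: p; q]>>%VS.
Proof. by move=> f; exists (exist (fun U : {vspace 'cV[K]_3} => \dim U == 2%N) _ f). Qed.

Lemma pline_eq l (p q : 'cV[K]_3) : free [:: p; q] -> p \in val l -> q \in val l ->
  val l = <<[:: p; q]>>%VS.
Proof.
move=> f pl ql; apply/esym/eqP; rewrite eqEdim (eqP f) (eqP (valP l)) leqnn andbT.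
by apply/span_subvP => v; rewrite !inE => /orP [] /eqP ->.
Qed.

Lemma free3_basis e : free e -> basis_of fullv e.
Proof. by move=> f; rewrite basisEfree f subvf dimvf dim_matrix size_tuple. Qed.

Lemma collinear_affine_pt n e (W : 'I_n -> ppoint K) (x z : 'I_n -> K) i j k :
  free e -> (forall m, val (W m) = <[affine_pt e (x m) (z m)]>%VS) -> x i != x j ->
  (exists l, [/\ on_line (W i) l, on_line (W j) l & on_line (W k) l]) <->
  cdet x z i j k = 0.
Proof.
move=> fe WE xij; have f3 := affine_pt_free3 fe (z i) (z j) (x k) (z k) xij.
rewrite /on_line; split=> [[l]|/eqP d0].
  rewrite !WE -!memvE => -[il jl kl]; apply/eqP; rewrite -[_ == _]negbK -f3.
  apply/negP => /eqP d3; have : (\dim <<[:: affine_pt e (x i) (z i); affine_pt e (x j) (z j);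
      affine_pt e (x k) (z k)]>> <= \dim (val l))%N.
    by apply/dimvS/span_subvP => v; rewrite !inE => /or3P [] /eqP ->.
  by rewrite d3 (eqP (valP l)).
have f2 := affine_pt_free2 fe (z i) (z j) xij.
have [l lE] := pline_span f2.
exists l; rewrite !WE lE -!memvE; split; try by rewrite memv_span // !inE eqxx ?orbT.
move: f3; rewrite d0 (@perm_free _ _ _ [:: affine_pt e (x k) (z k); affine_pt e (x i) (z i);
  affine_pt e (x j) (z j)]).
  by rewrite free_cons f2 andbT => /negbFE.
by rewrite (perm_catC [:: _; _] [:: _]).
Qed.

Lemma projection_lift P l V (p q : 'cV[K]_3) c : ~~ on_line P l -> val P = <[p]>%VS ->
  q \in val l -> q != 0 -> val V = <[q + c *: p]>%VS -> projection P l V = <[q]>%VS.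
Proof.
move=> Pl PE ql q0 VE; rewrite /projection; apply/esym/eqP; rewrite eqEdim.
rewrite dim_vline q0 -memvE memv_cap ql andbT; apply/andP; split.
  rewrite -[q](addrK (c *: p)) addrC PE VE; apply: memv_add; last exact: memv_line.
  by rewrite memvN memvZ // memv_line.
have dPV : (\dim (val P + val V) <= 2)%N.
  have := dimv_sum_cap (val P) (val V).
  by rewrite (eqP (valP P)) (eqP (valP V)); lia.
rewrite leqNgt; apply/negP => d2; move/negP: Pl; apply; rewrite /on_line.
have /eqP e : ((val P + val V) :&: val l == val P + val V)%VS.
  by rewrite eqEdim capvSl (leq_trans dPV).
by apply: subv_trans (addvSl _ (val V)) _; rewrite -e capvSr.
Qed.

Lemma projection_lift_inv P l V (p q : 'cV[K]_3) : ~~ on_line P l -> val P = <[p]>%VS ->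
  q \in val l -> q != 0 -> projection P l V = <[q]>%VS ->
  exists c, val V = <[q + c *: p]>%VS.
Proof.
move=> Pl PE ql q0 prE; have : q \in (val P + val V)%VS.
  by have := memv_line q; rewrite -prE memv_cap => /andP [].
rewrite PE => /memv_addP [_ /vlineP [a ->] [v vV qE]].
exists (- a); rewrite scaleNr {1}qE addrAC subrr add0r.
apply/esym/eqP; rewrite eqEdim (eqP (valP V)) dim_vline -memvE vV /=.
rewrite lt0b; apply: contraNneq Pl => v0; rewrite v0 addr0 in qE.
have a0 : a != 0 by apply: contraNneq q0 => a0; rewrite qE a0 scale0r.
rewrite /on_line PE -memvE -[p]scale1r -(mulVf a0) -scalerA -qE; exact: memvZ.
Qed.

Lemma exists_coords n l (Q : 'I_n -> ppoint K) : infinite_field K -> distinct_on_line l Q ->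
  exists P e (x : 'I_n -> K), [/\ ~~ on_line P l, has_coords e P Q x, injective x &
    forall j, affine_pt e (x j) 0 \in val l].
Proof.
move=> Kinf [Qi Ql]; pose b := vbasis (val l).
have bl := vbasisP (val l); have dl := eqP (valP l).
have sb : size b = 2%N by rewrite size_tuple dl.
have [f0 [f1 bE]] : exists f0 f1, tval b = [:: f0; f1].
  by case: (tval b) sb => [|f0 [|f1 [|]]] // _; exists f0, f1.
have ff : free [:: f0; f1] by rewrite -bE (basis_free bl).
have lE : val l = <<[:: f0; f1]>>%VS by rewrite -bE (span_basis bl).
have [u ul] : exists u, u \notin val l.
  have [s|/subvPn [u _ ?]] := boolP (fullv <= val l)%VS; last by exists u.
  by have := dimvS s; rewrite dl dimvf dim_matrix.
have : forall j, exists ab : K * K, val (Q j) = <[ab.1 *: f0 + ab.2 *: f1]>%VS.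
  move=> j; have [q q0 QE] := ppointP (Q j).
  have : q \in val l by rewrite memvE -QE; apply: Ql.
  rewrite lE span_cons span_seq1 => /memv_addP [_ /vlineP [a ->] [_ /vlineP [c ->] qE]].
  by exists (a, c); rewrite QE qE.
case/fin_all_exists => ab QE.
have [s hs] := Kinf [seq (ab j).2 / (ab j).1 | j <- enum 'I_n].
pose d j := (ab j).2 - (ab j).1 * s.
pose e := [tuple f0 + s *: f1; f1; u].
have Q0 j : (ab j).1 *: f0 + (ab j).2 *: f1 != 0.
  by have := eqP (valP (Q j)); rewrite QE dim_vline; case: eqP.
have d0 j : d j != 0.
  rewrite subr_eq0; apply/eqP => e2.
  have a0 : (ab j).1 != 0.
    by apply: contraNneq (Q0 j) => a0; rewrite e2 a0 mul0r !scale0r addr0.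
  move/negP: hs; apply; apply/mapP; exists j; first by rewrite mem_enum.
  by rewrite e2 mulrC mulKf.
have fe : free e.
  rewrite (@perm_free _ _ _ [:: u; f0 + s *: f1; f1]); last first.
    by rewrite (perm_catC [:: _; _] [:: _]).
  pose t := [:: f0 + s *: f1; f1].
  have span_t : <<t>>%VS = val l.
    rewrite lE /t !span_cons span_nil !addv0; apply/eqP; rewrite eqEsubv !subv_add.
    rewrite !addvSr !andbT -!memvE; apply/andP; split.
      by apply: memv_add; rewrite ?memvZ ?memv_line.
    rewrite -[X in X \in _](addrK (s *: f1)); apply: memv_add; first exact: memv_line.
    by rewrite memvN memvZ ?memv_line.
  by rewrite free_cons -/t span_t ul /free span_t dl.
have [P PE] : exists P, val P = <[u]>%VS.
  by apply: ppoint_line; apply: contraNneq ul => ->; rewrite mem0v.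
have QE' j : val (Q j) = <[affine_pt e ((ab j).1 / d j) 0]>%VS.
  rewrite QE /affine_pt /= scale0r addr0.
  have -> : (ab j).1 *: f0 + (ab j).2 *: f1 =
      d j *: (((ab j).1 / d j) *: (f0 + s *: f1) + f1).
    rewrite scalerDr scalerA mulrC divfK // scalerDr scalerA -addrA -scalerDl.
    by congr (_ + _ *: _); rewrite /d; ring.
  apply/eqP; rewrite eqEdim !dim_vline scaler_eq0 (negPf (d0 j)) /= leqnn andbT -memvE.
  by rewrite memvZ ?memv_line.
exists P, e, (fun j => (ab j).1 / d j); split.
- by rewrite /on_line PE -memvE.
- split; first exact: free3_basis.
    by rewrite PE /= !scale0r !add0r scale1r.
  by move=> j; rewrite QE' /affine_pt scale1r.
- by move=> i j /= h; apply: Qi; apply: val_inj; rewrite !QE' h.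
- by move=> j; rewrite memvE -QE'; apply: Ql.
Qed.

End Plane.

Section Main.
Variables (K : fieldType) (n : nat) (C : config 'I_n).
Hypothesis Kinf : infinite_field K.
Hypothesis C_points : points C = [set: 'I_n].
Hypothesis C_linear : linear_config C.
Hypothesis C_components : forall A, A \in component_sets C ->
   exists M : matroid 'I_n, maximal_matroid K M /\ subconfig C A = matroid_config M.

Lemma has_coords_affine_pt (e : 3.-tuple 'cV[K]_3) P (Q : 'I_n -> ppoint K) x :
  has_coords e P Q x -> [/\ free e, val P = <[e`_2]>%VS &
    forall j, val (Q j) = <[affine_pt e (x j) 0]>%VS].
Proof.
case=> be PE QE; split; first exact: basis_free be.
  by rewrite PE !scale0r !add0r scale1r.
by move=> j; rewrite QE /affine_pt scale1r.
Qed.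

Definition rank_condition :=
  forall (l : pline K) (Q : 'I_n -> ppoint K), distinct_on_line l Q ->
    forall (P : ppoint K) (e : 3.-tuple 'cV[K]_3) (x : 'I_n -> K),
      ~~ on_line P l -> has_coords e P Q x ->
      (3 * omega C <= \dim (solution_space (collinearity_matrix C x)))%N.

Lemma rank_condition_injective : rank_condition -> forall x : 'I_n -> K, injective x ->
  (3 * omega C <= \dim (solution_space (collinearity_matrix C x)))%N.
Proof.
move=> rc x xi; have [e fe] := exists_free3 K.
have eE : tval e = [:: e`_0; e`_1; e`_2].
  by case: e {fe} => [[|a [|b [|c [|]]]]].
move: (fe); rewrite eE (@perm_free _ _ _ [:: e`_2; e`_0; e`_1]); last first.
  by rewrite (perm_catC [:: _; _] [:: _]).
rewrite free_cons => /andP [e2 f01]; have [l lE] := pline_span f01.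
have [P PE] : exists P : ppoint K, val P = <[e`_2]>%VS.
  by apply: ppoint_line; apply: contraNneq e2 => ->; rewrite mem0v.
have /fin_all_exists [Q QE] j := ppoint_line (affine_pt_neq0 fe (x j) 0).
apply: (rc l Q _ P e).
- split=> [i j /(congr1 val)|j]; first by rewrite !QE => /(affine_pt_line_inj fe) [/xi].
  rewrite /on_line QE lE -memvE /affine_pt scale0r addr0.
  by rewrite memvD ?memvZ // memv_span // !inE eqxx ?orbT.
- by rewrite /on_line PE lE -memvE.
- split; first exact: free3_basis.
    by rewrite PE !scale0r !add0r scale1r.
  by move=> j; rewrite QE /affine_pt scale1r.
Qed.

Lemma rank_condition_liftable : rank_condition -> liftable K C.
Proof.
move=> rc l Q dQ.
have two := components_two_lines Kinf C_points C_components (rank_condition_injective rc).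
have [P [e [x [Pl co xi ql]]]] := exists_coords Kinf dQ.
have [fe PE QE] := has_coords_affine_pt co.
have [z [Lz nz]] := generic_lift Kinf C_points C_linear C_components xi two.
have /fin_all_exists [V VE] j := ppoint_line (affine_pt_neq0 fe (x j) (z j)).
exists P, V; split=> //.
  split=> [i j /(congr1 val)|i j k u]; first by rewrite !VE => /(affine_pt_line_inj fe) [/xi].
  have xij : x i != x j.
    by rewrite (inj_eq xi); case/and3P: u; rewrite inE negb_or => /andP [].
  split=> [[m mC [im jm km]]|/(collinear_affine_pt k fe VE xij) d0].
    by apply/(collinear_affine_pt k fe VE xij); apply: Lz mC im jm km.
  apply/collinearP; apply: contraT => nc.
  by have := nz i j k u nc; rewrite d0 eqxx.
move=> j; rewrite QE; apply: (projection_lift (c := z j) Pl PE (ql j) (affine_pt_neq0 fe _ _)).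
by rewrite VE /affine_pt scale0r addr0.
Qed.

Lemma liftable_rank_condition : liftable K C -> rank_condition.
Proof.
move=> lif l Q dQ P0 e x P0l co.
have [fe _ QE] := has_coords_affine_pt co.
have [/eqP c0|/card_gt0P [A AC]] := posnP #|component_sets C|.
  by rewrite /omega (eqP c0) muln0.
have [Qi Ql] := dQ.
have xi : injective x by move=> i j h; apply: Qi; apply: val_inj; rewrite !QE h.
have [i [j [k [u _ _]]]] := component_noncollinear C_points C_components AC.
have ij : i != j by case/and3P: u; rewrite inE negb_or => /andP [].
have xij : x i != x j by rewrite (inj_eq xi).
have ql m : affine_pt e (x m) 0 \in val l by rewrite memvE -QE; apply: Ql.
have f2 := affine_pt_free2 fe 0 0 xij.
have eE : tval e = [:: e`_0; e`_1; e`_2] by case: (e) => [[|a [|b [|c [|]]]]].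
have f01 : free [:: e`_0; e`_1].
  by apply: (@catl_free _ _ [:: e`_2]); rewrite /= -eE.
have lE : val l = <<[:: e`_0; e`_1]>>%VS.
  rewrite (pline_eq f2 (ql i) (ql j)); have [l' l'E] := pline_span f01.
  rewrite -l'E; apply/esym/pline_eq => //; rewrite l'E /affine_pt scale0r addr0;
    by rewrite memvD ?memvZ // memv_span // !inE eqxx ?orbT.
have [P [V [Pl nd pr]]] := lif l Q dQ.
have [p p0 PE] := ppointP P.
pose e' := [tuple e`_0; e`_1; p].
have fe' : free e'.
  rewrite (@perm_free _ _ _ [:: p; e`_0; e`_1]); last first.
    by rewrite (perm_catC [:: _; _] [:: _]).
  by rewrite free_cons f01 -lE andbT memvE -PE.
have /fin_all_exists [z zE] : forall m, exists c, val (V m) = <[affine_pt e' (x m) c]>%VS.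
  move=> m; have [|c ->] := projection_lift_inv (V := V m) Pl PE (ql m) (affine_pt_neq0 fe _ _).
    by rewrite pr QE.
  by exists c; rewrite /affine_pt /= scale0r addr0.
have [_ ndV] := nd.
have xne a b c : uniq [:: a; b; c] -> x a != x b.
  by rewrite (inj_eq xi) => /and3P []; rewrite inE negb_or => /andP [].
apply: (@dim_of_lift _ _ _ C_points C_components x z).
  move=> m a b c mC am bm cm; have [uu|uu] := boolP (uniq [:: a; b; c]); last exact: cdet_not_uniq.
  by apply/(collinear_affine_pt c fe' zE (xne _ _ _ uu))/ndV => //; exists m.
move=> a b c uu; apply: contra => /eqP d0; apply/collinearP.
by apply/(ndV _ _ _ uu)/(collinear_affine_pt c fe' zE (xne _ _ _ uu)).
Qed.

End Main.

Theorem lemma3p9 (R : realType) (n : nat) (C : config 'I_n)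
    (C_points : points C = [set: 'I_n])
    (C_linear : linear_config C)
    (C_components : forall A, A \in component_sets C ->
       exists M : matroid 'I_n,
         maximal_matroid (complex R) M /\ subconfig C A = matroid_config M) :
  (liftable (complex R) C <->
   (forall (l : pline (complex R)) (Q : 'I_n -> ppoint (complex R)),
      distinct_on_line l Q ->
      forall (P : ppoint (complex R)) (e : 3.-tuple 'cV[complex R]_3)
             (x : 'I_n -> complex R),
        ~~ on_line P l -> has_coords e P Q x ->
        (3 * omega C <= \dim (solution_space (collinearity_matrix C x)))%N))
  /\
  (forall x : 'I_n -> complex R,
     (3 * omega C <= \dim (solution_space (collinearity_matrix C x)))%N <->
     (\rank (collinearity_matrix C x))%:Z <= n%:Z - (3 * omega C)%:Z).
Proof.
have Kinf : infinite_field (complex R) by exact: infinite_numField.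
split; first split.
- exact: liftable_rank_condition.
- exact: rank_condition_liftable.
move=> x; have := dim_solution_space (collinearity_matrix C x); lia.
Qed.
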